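(* Let $\mathcal H_{\mathbb R}$ be a real Hilbert space and let $X_N(f)$ ($f\in\mathcal H_{\mathbb R}$) be a family of Hermitian Gaussian $N\times N$ random matrices. Then for all $n,m\in\mathbb N$ ($n,m\ge 1$) and all $f_1,\dots,f_n,g_1,\dots,g_m\in\mathcal H_{\mathbb R}$, $$\lim_{N\to\infty}k_2\{\mathrm{Tr}[X_N(f_1)\cdots X_N(f_n)],\ \mathrm{Tr}[X_N(g_1)\cdots X_N(g_m)]\}=\langle \mathbf c\,\omega(f_1)\cdots\omega(f_n)\Omega,\ \mathbf c\,\omega(g_m)\cdots\omega(g_1)\Omega\rangle_{\mathrm{cyc}}.$$
   Context: Random matrices: $X_N(f)=(x_{ij}(f))_{i,j=1}^N$ is Hermitian for each $f\in\mathcal H_{\mathbb R}$, and the entries $\{x_{ij}(f): 1\le i,j\le N,\ f\in\mathcal H_{\mathbb R}\}$ form a centered Gaussian family with $E\{x_{ij}(f)x_{kl}(g)\}=0$ for $i<j$, $k<l$, and $E\{x_{ij}(f)\overline{x_{kl}(g)}\}=\delta_{ik}\delta_{jl}\frac1N\langle f,g\rangle$ for $i\le j$, $k\le l$. $\mathrm{Tr}$ is the un-normalized trace and $k_2\{a,b\}=E\{ab\}-E\{a\}E\{b\}$ (bilinear). Fock space: let $\mathcal H$ be the complexification of $\mathcal H_{\mathbb R}$, with inner product linear in the first argument and involution $\overline{f_1+if_2}=f_1-if_2$ ($f_1,f_2\in\mathcal H_{\mathbb R}$). The algebraic (linear) full Fock space is $\mathcal F_{\mathrm{lin}}(\mathcal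 H)=\mathbb C\Omega\oplus\bigoplus_{n\ge1}\mathcal H^{\otimes n}$ (algebraic). For $f\in\mathcal H$ the creation operator is $l(f)\Omega=f$, $l(f)f_1\otimes\cdots\otimes f_n=f\otimes f_1\otimes\cdots\otimes f_n$; the annihilation operator is $l^*(f)\Omega=0$, $l^*(f)f_1\otimes\cdots\otimes f_n=\langle f_1,f\rangle f_2\otimes\cdots\otimes f_n$ (with the empty tensor equal to $\Omega$). For $f\in\mathcal H_{\mathbb R}$, $\omega(f)=l(f)+l^*(f)$. Cyclic Fock space: $\mathcal F_{\mathrm{cyc}}(\mathcal H)=\bigoplus_{n\ge0}\mathcal H^{\otimes n}_{\mathrm{cyc}}$ (algebraic direct sum), where $\mathcal H^{\otimes n}_{\mathrm{cyc}}$ is spanned by circular tensors $[f_1\otimes\cdots\otimes f_n]$, which are multilinear in $f_1,\dots,f_n$ and invariant under cyclic rotation of $f_1,\dots,f_n$ (think of $f_1,\dots,f_n$ arranged on a circle). It carries the inner product (linear in the first, antilinear in the second argument) determined by $$\langle[f_1\otimes\cdots\otimes f_n],[g_1\otimes\cdots\otimes g_m]\rangle_{\mathrm{cyc}}=\delta_{nm}\sum_{k=0}^{n-1}\langle f_1,g_{1+k}\rangle\langle f_2,g_{2+k}\rangle\cdots\langle f_n,g_{n+k}\rangle,$$ indices of $g$ counted modulo $n$. The linear map $\mathbf c:\mathcal F_{\mathrm{lin}}(\mathcal H)\to\mathcal F_{\mathrm{cyc}}(\mathcal H)$ is defined recursively by $\mathbf c\,\Omega=0$, $\mathbf c(f)=[f]$,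 and for $n\ge2$ $$\mathbf c(f_1\otimes\cdots\otimes f_n)=[f_1\otimes\cdots\otimes f_n]+\langle f_1,\overline{f_n}\rangle\,\mathbf c(f_2\otimes\cdots\otimes f_{n-1}),$$ where for $n=2$ the argument of the last $\mathbf c$ is $\Omega$. *)

(* Defs.v *)
From HB Require Import structures.
From mathcomp Require Import all_boot all_order all_algebra.
From mathcomp Require Import finmap ring_quotient complex ring.
From mathcomp Require Import all_classical all_reals all_analysis.
(* The notations of monalg clash with those of analysis. *)
From mathcomp Require Import -(notations) monalg.

Set Implicit Arguments.
Unset Strict Implicit.
Unset Printing Implicit Defensive.
Import Order.TTheory GRing.Theory Num.Theory numFieldNormedType.Exports.
Local Open Scope classical_set_scope.
Local Open Scope complex_scope.
Local Open Scope quotient_scope.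
Local Open Scope ring_scope.

(* The module presented by generators [K] and relations [rel]: the free module
   on [K] divided by the submodule spanned by [rel]. *)
Section PresentedModule.
Variables (F : fieldType) (K : choiceType).
Notation free := (monalg.malg K F).
Variable rel : set free.

Inductive relspan : free -> Prop :=
| relspan0 : relspan 0
| relspanD (a : F) (r v : free) : rel r -> relspan v -> relspan (a *: r + v).

Definition relpred : {pred free} := fun v => `[< relspan v >].

Lemma relspan_add u v : relspan u -> relspan v -> relspan (u + v).
Proof.
elim=> [|a r w hr _ ih] hv; first by rewrite add0r.
by rewrite -addrA; apply: relspanD => //; exact: ih.
Qed.

Lemma relspan_scale a u : relspan u -> relspan (a *: u).
Proof.
elim=> [|b r w hr _ ih]; first by rewrite scaler0; exact: relspan0.
by rewrite scalerDr scalerA; exact: relspanD.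
Qed.

Lemma relpred_closed : zmod_closed relpred.
Proof.
split; first by apply/asboolP; exact: relspan0.
move=> u v /asboolP hu /asboolP hv; apply/asboolP.
by apply: relspan_add => //; rewrite -scaleN1r; exact: relspan_scale.
Qed.

HB.instance Definition _ := GRing.isZmodClosed.Build free relpred
  relpred_closed.

Definition presented := Quotient.quot relpred.
HB.instance Definition _ := GRing.Zmodule.on presented.

Definition cls (v : free) : presented := \pi_(Quotient.quot relpred) v.
Definition rep (u : presented) : free := repr (u : Quotient.quot relpred).

Lemma repK u : cls (rep u) = u. Proof. exact: reprK. Qed.

Lemma clsP u v : cls u = cls v <-> relspan (u - v).
Proof.
split=> [/eqP|h].
  by rewrite /cls -Quotient.idealrBE => /asboolP.
by apply/eqP; rewrite /cls -Quotient.idealrBE; apply/asboolP.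
Qed.

Lemma clsD : {morph cls : u v / u + v}.
Proof. by move=> u v; rewrite /cls raddfD. Qed.

Definition pscale (a : F) (u : presented) : presented := cls (a *: rep u).

Lemma pscale_cls a v : pscale a (cls v) = cls (a *: v).
Proof.
apply/clsP; rewrite -scalerBr; apply: relspan_scale; apply/clsP.
exact: repK.
Qed.

Lemma pscaleA a b u : pscale a (pscale b u) = pscale (a * b) u.
Proof. by rewrite -[u]repK !pscale_cls scalerA. Qed.
Lemma pscale1 : left_id 1 pscale.
Proof. by move=> u; rewrite /pscale scale1r repK. Qed.
Lemma pscaleDr : right_distributive pscale +%R.
Proof.
move=> a u v.
by rewrite -[u]repK -[v]repK -clsD !pscale_cls scalerDr clsD.
Qed.
Lemma pscaleDl u : {morph pscale^~ u : a b / a + b}.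
Proof. by move=> a b; rewrite /pscale scalerDl clsD. Qed.

HB.instance Definition _ := GRing.Zmodule_isLmodule.Build F presented
  pscaleA pscale1 pscaleDr pscaleDl.

Lemma cls_is_linear : linear cls.
Proof. by move=> a u v; rewrite clsD -pscale_cls. Qed.
HB.instance Definition _ := GRing.isLinear.Build F free presented _ cls
  cls_is_linear.

Definition gen (k : K) : presented := cls (mkmalgU k 1).

Section Lift.
Variables (W : lmodType F) (phi : K -> W).

Definition free_lift (v : free) : W := \sum_(k <- msupp v) mcoeff k v *: phi k.

Lemma free_liftEw (d : {fset K}) v : (msupp v `<=` d)%fset ->
  free_lift v = \sum_(k <- d) mcoeff k v *: phi k.
Proof.
move=> le; apply: big_fset_incl => // k _ /mcoeff_outdom ->.
by rewrite scale0r.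
Qed.

Lemma free_lift_is_linear : linear free_lift.
Proof.
move=> a u v; pose d := (msupp u `|` msupp v)%fset.
have du : (msupp u `<=` d)%fset by exact: fsubsetUl.
have dv : (msupp v `<=` d)%fset by exact: fsubsetUr.
have duv : (msupp (a *: u + v) `<=` d)%fset.
  apply: (fsubset_trans (msuppD_le _ _)).
  by apply: fsetSU; exact: msuppZ_le.
rewrite (free_liftEw du) (free_liftEw dv) (free_liftEw duv) scaler_sumr.
rewrite -big_split /=; apply: eq_bigr => k _.
by rewrite mcoeffD mcoeffZ scalerDl scalerA.
Qed.
HB.instance Definition _ := GRing.isLinear.Build F free W _ free_lift
  free_lift_is_linear.

Lemma free_liftU k : free_lift (mkmalgU k 1) = phi k.
Proof.
rewrite (free_liftEw (msuppU_le)) big_seq_fset1 mcoeffUU.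
by rewrite scale1r.
Qed.

(* The universal property.  The value of [lift] is meaningful only when [phi]
   respects the relations; see [lift_gen] and [lift_is_linear]. *)
Definition lift (u : presented) : W := free_lift (rep u).

Definition respects := forall r, rel r -> free_lift r = 0.

Hypothesis phi_rel : respects.

Lemma lift_cls v : lift (cls v) = free_lift v.
Proof.
have vanish w : relspan w -> free_lift w = 0.
  elim=> [|a r w' hr _ ih]; first exact: linear0.
  by rewrite free_lift_is_linear ih phi_rel// scaler0 addr0.
apply/eqP; rewrite -subr_eq0 -linearB; apply/eqP; apply: vanish.
by apply/clsP; rewrite repK.
Qed.

Lemma lift_gen k : lift (gen k) = phi k.
Proof. by rewrite lift_cls free_liftU. Qed.

Lemma lift_is_linear : linear lift.
Proof.
move=> a u v; rewrite -[u]repK -[v]repK -linearP !lift_cls.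
exact: linearP.
Qed.

End Lift.

End PresentedModule.

Section Complexification.
Variables (R : realType) (V : lmodType R).

(* [(x, y)] stands for [x + i y]. *)
Definition complexification : Type := (V * V)%type.
HB.instance Definition _ := GRing.Zmodule.on complexification.
Implicit Types u v : complexification.

Definition cplx_scale (a : R[i]) u : complexification :=
  (complex.Re a *: u.1 - complex.Im a *: u.2, complex.Re a *: u.2 + complex.Im a *: u.1).

Lemma cplx_scaleA a b u : cplx_scale a (cplx_scale b u) = cplx_scale (a * b) u.
Proof.
case: a b u => [a a'] [b b'] [x y]; congr pair => /=.
  rewrite !scalerBr !scalerDr !scalerA scalerBl scalerDl !opprD !addrA.
  by rewrite addrAC [X in X - _]addrAC.
rewrite !scalerBr !scalerDr !scalerA scalerBl scalerDl !addrA.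
by rewrite addrAC [X in X + _]addrAC.
Qed.
Lemma cplx_scale1 : left_id 1 cplx_scale.
Proof. by case=> x y; rewrite /cplx_scale /= !scale1r !scale0r subr0 addr0. Qed.
Lemma cplx_scaleDr : right_distributive cplx_scale +%R.
Proof.
by move=> a [x y] [z t]; congr pair => /=; rewrite !scalerDr ?opprD addrACA.
Qed.
Lemma cplx_scaleDl u : {morph cplx_scale^~ u : a b / a + b}.
Proof.
move=> [a a'] [b b']; case: u => x y; congr pair => /=;
  by rewrite !scalerDl ?opprD addrACA.
Qed.
HB.instance Definition _ := GRing.Zmodule_isLmodule.Build R[i] complexification
  cplx_scaleA cplx_scale1 cplx_scaleDr cplx_scaleDl.

Definition of_real (x : V) : complexification := (x, 0).

Definition cplx_conj u : complexification := (u.1, - u.2).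

Definition cplx_dot (dot : {dot V for idfun}) u v : R[i] :=
  (dot u.1 v.1 + dot u.2 v.2) +i* (dot u.2 v.1 - dot u.1 v.2).

Section Dot.
Variable dot : {dot V for idfun}.

Lemma cplx_dotPl w a u v :
  cplx_dot dot (a *: u + v) w = a * cplx_dot dot u w + cplx_dot dot v w.
Proof.
case: a u v w => [a b] [x x'] [y y'] [z z'].
by congr Complex => /=; rewrite !(linearDl, linearNl, linearZl_LR) /=; ring.
Qed.

Lemma cplx_dotC u v : cplx_dot dot u v = (cplx_dot dot v u)^*.
Proof.
have dotC x y : dot x y = dot y x.
  by rewrite hermC /= expr0 mul1r.
by congr Complex => /=; rewrite ?opprB; congr (_ + _); rewrite dotC.
Qed.

Lemma cplx_dotPr w a u v :
  cplx_dot dot w (a *: u + v) = a^* * cplx_dot dot w u + cplx_dot dot w v.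
Proof.
by rewrite cplx_dotC cplx_dotPl rmorphD rmorphM /= -!cplx_dotC.
Qed.

Lemma cplx_conjP a u v : cplx_conj (a *: u + v) = a^* *: cplx_conj u + cplx_conj v.
Proof.
case: a u v => [a b] [x x'] [y y']; congr pair => /=.
  by rewrite scaleNr opprK scalerN.
by rewrite opprD opprD scalerN scaleNr.
Qed.

Lemma cplx_dot_conjPr w a u v :
  cplx_dot dot w (cplx_conj (a *: u + v)) =
  a * cplx_dot dot w (cplx_conj u) + cplx_dot dot w (cplx_conj v).
Proof. by rewrite cplx_conjP cplx_dotPr conjCK. Qed.

End Dot.

End Complexification.

Section Multilinear.
Variables (F : fieldType) (V W : lmodType F).

Definition multilinear (phi : seq V -> W) := forall s t a x y,
  phi (s ++ (a *: x + y) :: t) = a *: phi (s ++ x :: t) + phi (s ++ y :: t).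

Definition multilin_rel : set (malg (seq V) F) :=
  [set r | exists s t a x y, r = mkmalgU (s ++ (a *: x + y) :: t) 1
    - (a *: mkmalgU (s ++ x :: t) 1 + mkmalgU (s ++ y :: t) 1)].

Definition rotation_rel : set (malg (seq V) F) :=
  [set r | exists x s, r = mkmalgU (x :: s) 1 - mkmalgU (rcons s x) 1].

Lemma respects_multilin phi :
  multilinear phi -> respects multilin_rel phi.
Proof.
move=> hphi _ [s [t [a [x [y ->]]]]].
by rewrite linearB linearP /= !free_liftU hphi subrr.
Qed.

Lemma respects_cyclic phi : multilinear phi ->
  (forall x s, phi (x :: s) = phi (rcons s x)) ->
  respects (multilin_rel `|` rotation_rel) phi.
Proof.
move=> hphi hrot r [|[x [s ->]]]; first exact: respects_multilin.
by rewrite linearB /= !free_liftU hrot subrr.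
Qed.

End Multilinear.

(* Words of length [n] generate the summand of degree [n]; the relations are
   homogeneous, and [gen [:: f1; ..; fn]] is [f1 (x) .. (x) fn]. *)
Definition full_fock (F : fieldType) (V : lmodType F) :=
  presented (@multilin_rel F V).

Definition cyclic_fock (F : fieldType) (V : lmodType F) :=
  presented (@multilin_rel F V `|` @rotation_rel F V).

HB.instance Definition _ (F : fieldType) (V : lmodType F) :=
  GRing.Lmodule.on (full_fock V).
HB.instance Definition _ (F : fieldType) (V : lmodType F) :=
  GRing.Lmodule.on (cyclic_fock V).

Section FockGenerators.
Variables (F : fieldType) (V : lmodType F).

Definition tensor (s : seq V) : full_fock V := gen _ s.
Definition vacuum : full_fock V := tensor [::].
Definition circular (s : seq V) : cyclic_fock V := gen _ s.

Lemma gen_rel (K : choiceType) (rel : set (malg K F)) r :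
  rel r -> cls rel r = 0.
Proof.
move=> hr; rewrite -(linear0 (cls rel)); apply/clsP.
by rewrite subr0 -[r]addr0 -[r]scale1r; apply: relspanD => //; exact: relspan0.
Qed.

Lemma tensor_multilinear : multilinear tensor.
Proof.
move=> s t a x y; apply/eqP; rewrite -subr_eq0 -linearP -linearB.
by apply/eqP/gen_rel; exists s, t, a, x, y.
Qed.

Lemma circular_multilinear : multilinear circular.
Proof.
move=> s t a x y; apply/eqP; rewrite -subr_eq0 -linearP -linearB.
by apply/eqP/gen_rel; left; exists s, t, a, x, y.
Qed.

Lemma circular_rot x s : circular (x :: s) = circular (rcons s x).
Proof.
apply/eqP; rewrite -subr_eq0 -linearB.
by apply/eqP/gen_rel; right; exists x, s.
Qed.

End FockGenerators.

Section Fock.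
Variables (R : realType) (H : lmodType R) (dot : {dot H for idfun}).
Notation HC := (complexification H).
Notation "<| u , v |>" := (cplx_dot dot u v).

Definition creation (f : HC) : full_fock HC -> full_fock HC :=
  lift (fun s => tensor (f :: s)).

Definition annihilation (f : HC) : full_fock HC -> full_fock HC :=
  lift (fun s => if s is g :: s' then <|g, f|> *: tensor s' else 0).

Definition omega (f : H) (v : full_fock HC) : full_fock HC :=
  creation (of_real f) v + annihilation (of_real f) v.

Lemma creation_respects f :
  respects (@multilin_rel _ HC) (fun s => tensor (f :: s)).
Proof. by apply: respects_multilin => s; exact: (tensor_multilinear (f :: s)). Qed.

Lemma creation_is_linear f : linear (creation f).
Proof. exact/lift_is_linear/creation_respects. Qed.

Lemma creationE f s : creation f (tensor s) = tensor (f :: s).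
Proof. exact/lift_gen/creation_respects. Qed.

Lemma annihilation_respects f : respects (@multilin_rel _ HC)
  (fun s => if s is g :: s' then <|g, f|> *: tensor s' else 0).
Proof.
apply: respects_multilin => -[|g s] t a x y /=.
  by rewrite cplx_dotPl scalerDl scalerA.
by rewrite tensor_multilinear scalerDr !scalerA mulrC.
Qed.

Lemma annihilation_is_linear f : linear (annihilation f).
Proof. exact/lift_is_linear/annihilation_respects. Qed.

Lemma annihilation_vacuum f : annihilation f (vacuum _) = 0.
Proof. exact: (lift_gen (@annihilation_respects f)). Qed.

Lemma annihilationE f g s :
  annihilation f (tensor (g :: s)) = <|g, f|> *: tensor s.
Proof. exact: (lift_gen (@annihilation_respects f)). Qed.

(* [n] bounds the length of the word; see [cword_rcons]. *)
Fixpoint cword_rec (n : nat) (s : seq HC) : cyclic_fock HC :=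
  match n, s with
  | n'.+1, [:: f] => circular [:: f]
  | n'.+1, f :: g :: s' => circular s +
      <|f, cplx_conj (last g s')|> *: cword_rec n' (belast g s')
  | _, _ => 0
  end.

Definition cword (s : seq HC) := cword_rec (size s) s.

Definition cmap : full_fock HC -> cyclic_fock HC := lift cword.

Lemma cword_rcons f s g :
  cword (f :: rcons s g) =
  circular (f :: rcons s g) + <|f, cplx_conj g|> *: cword s.
Proof.
have recE n x y w : cword_rec n.+1 [:: x, y & w] = circular [:: x, y & w] +
    <|x, cplx_conj (last y w)|> *: cword_rec n (belast y w).
  exact: erefl.
have irrel n m w : (size w <= n)%N -> (size w <= m)%N ->
    cword_rec n w = cword_rec m w.
  elim: n m w => [|n ih] m w.
    by rewrite leqn0 size_eq0 => /eqP ->; case: m.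
  case: w => [|x [|y w]].
  - by case: m.
  - by case: m => [|m] // _ _; exact: erefl.
  case: m => [|m] hn hm; first by discriminate hm.
  by rewrite !recE (ih m) ?size_belast; [|exact: ltnW|exact: ltnW].
rewrite /cword [size (f :: _)]/= size_rcons.
case: s => [|h s].
  by rewrite [rcons _ _]/= recE; congr (_ + _ *: _).
rewrite rcons_cons (recE (size (h :: s)).+1 f h (rcons s g)).
rewrite last_rcons belast_rcons (irrel _ (size (h :: s)))//; exact: ltnW.
Qed.

Lemma cword_multilinear : multilinear cword.
Proof.
have main n s t a x y : (size s + size t <= n)%N ->
    cword (s ++ (a *: x + y) :: t) =
    a *: cword (s ++ x :: t) + cword (s ++ y :: t).
  elim: n s t => [|n ih] [|f s] t; rewrite ?addSn//.
  - by case: t => //= _; exact: (circular_multilinear [::] [::]).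
  - case/lastP: t => [|t g] hn /=.
      exact: (circular_multilinear [::] [::]).
    rewrite !cword_rcons (circular_multilinear [::]) cplx_dotPl scalerDr.
    by rewrite scalerDl scalerA addrACA.
  - case/lastP: t => [|t g] hn.
      rewrite !cats1 /= !cword_rcons -!cats1 (circular_multilinear (f :: s)).
      by rewrite cplx_dot_conjPr scalerDr scalerDl scalerA addrACA.
    rewrite /= -!rcons_cons -!rcons_cat !cword_rcons.
    rewrite ih; last first.
      by move: hn; rewrite size_rcons addnS ltnS; exact: leq_trans.
    have := circular_multilinear (f :: s) (rcons t g) a x y.
    rewrite /= -!rcons_cons -!rcons_cat => ->.
    by rewrite !scalerDr !scalerA addrACA [_ * a]mulrC.
by move=> s t a x y; exact: (main _ s t).
Qed.

Lemma cmap_is_linear : linear cmap.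
Proof. exact/lift_is_linear/respects_multilin/cword_multilinear. Qed.

Lemma cmapE s : cmap (tensor s) = cword s.
Proof. exact/lift_gen/respects_multilin/cword_multilinear. Qed.

Lemma cmap_vacuum : cmap (vacuum _) = 0.
Proof. exact: cmapE. Qed.

Lemma cmap1 f : cmap (tensor [:: f]) = circular [:: f].
Proof. exact: cmapE. Qed.

Lemma cmap_rcons f s g : cmap (tensor (f :: rcons s g)) =
  circular (f :: rcons s g) + <|f, cplx_conj g|> *: cmap (tensor s).
Proof. by rewrite !cmapE cword_rcons. Qed.

(* [cyc_word [::] [::]] is the empty sum, hence 0; the image of [cmap] has no
   component in degree 0. *)
Definition cyc_word (s t : seq HC) : R[i] :=
  if size s == size t then
    \sum_(k < size s) \prod_(i < size s)
      <|nth 0 s i, nth 0 t ((i + k) %% size s)|>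
  else 0.

(* The inner conjugation makes the map to be lifted linear in [v]; see
   [cyc_dotPl], [cyc_dotPr] and [cyc_dotE]. *)
Definition cyc_dot (u v : cyclic_fock HC) : R[i] :=
  lift (fun s => (lift (fun t => (cyc_word s t)^* : R[i]^o) v)^* : R[i]^o) u.

Lemma cyc_word_ord n s t : size s = n.+1 -> size t = n.+1 ->
  cyc_word s t = \sum_(k < n.+1) \prod_(i < n.+1) <|nth 0 s i, nth 0 t (i + k)%R|>.
Proof. by rewrite /cyc_word => -> ->; rewrite eqxx. Qed.

Lemma cyc_wordPl t : multilinear (cyc_word^~ t : seq HC -> R[i]^o).
Proof.
move=> s1 s2 a x y; rewrite /cyc_word !size_cat [size (_ :: _)]/=.
rewrite ![size (_ :: s2)]/=; set n := (_ + (size s2).+1)%N.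
case: eqP => _; last by rewrite scaler0 addr0.
rewrite scaler_sumr -big_split /=; apply: eq_bigr => k _.
have hi : (size s1 < n)%N by rewrite /n -addSnnS ltnS leq_addr.
have prodE z : \prod_(i < n) <|nth 0 (s1 ++ z :: s2) i, nth 0 t ((i + k) %% n)|>
  = <|z, nth 0 t ((size s1 + k) %% n)|> *
    \prod_(i < n | i != Ordinal hi)
      <|nth 0 (s1 ++ 0 :: s2) i, nth 0 t ((i + k) %% n)|>.
  rewrite (bigD1 (Ordinal hi)) //= nth_cat ltnn subnn /=; congr (_ * _).
  apply: eq_bigr => i ne; rewrite !nth_cat; case: ltnP => // le.
  have : (i - size s1)%N != 0%N.
    by rewrite subn_eq0 -ltnNge ltn_neqAle le andbT eq_sym.
  by case: (_ - _)%N.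
by rewrite !prodE cplx_dotPl mulrDl -mulrA.
Qed.

Lemma cyc_wordC s t : cyc_word s t = (cyc_word t s)^*.
Proof.
have [e|ne] := eqVneq (size s) (size t); last first.
  by rewrite /cyc_word (negbTE ne) eq_sym (negbTE ne) conjC0.
have [s0|] := posnP (size s).
  by rewrite /cyc_word -e eqxx s0 !big_ord0 conjC0.
move=> s_gt0; have es := esym (prednK s_gt0); move: es e; set n := (size s).-1 => es e.
rewrite !(@cyc_word_ord n) -?e// rmorph_sum (reindex_inj oppr_inj).
apply: eq_bigr => k _; rewrite rmorph_prod (reindex_inj (addIr k)).
apply: eq_bigr => i _. by rewrite addrK cplx_dotC.
Qed.

Lemma cyc_word_rot t x s : cyc_word (x :: s) t = cyc_word (rcons s x) t.
Proof.
have [e|ne] := eqVneq (size t) (size s).+1; last first.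
  by rewrite /cyc_word /= size_rcons eq_sym (negbTE ne).
rewrite !(@cyc_word_ord (size s)) ?size_rcons//.
pose c : 'I_(size s).+1 := inZp 1.
have nthE (i : 'I_(size s).+1) : nth 0 (rcons s x) i = nth 0 (x :: s) (i + c)%R.
  rewrite /= modnDmr addn1 nth_rcons.
  have [lt|le] := ltnP i (size s); first by rewrite modn_small.
  have -> : i = size s :> nat by apply/eqP; rewrite eqn_leq le -ltnS ltn_ord.
  by rewrite eqxx modnn.
rewrite [RHS](reindex_inj (addIr c)); apply: eq_bigr => k _.
rewrite (reindex_inj (addIr c)); apply: eq_bigr => i _.
by rewrite nthE addrAC addrA.
Qed.

Lemma cyc_word_respects s : respects (@multilin_rel _ HC `|` @rotation_rel _ HC)
  (fun t => (cyc_word s t)^* : R[i]^o).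
Proof.
apply: respects_cyclic => [s1 s2 a x y|x t].
  by rewrite -!cyc_wordC; exact: cyc_wordPl.
by rewrite -!cyc_wordC; exact: cyc_word_rot.
Qed.

Lemma cyc_dot_respects (v : cyclic_fock HC) : respects (@multilin_rel _ HC `|` @rotation_rel _ HC)
  (fun s => (lift (fun t => (cyc_word s t)^* : R[i]^o) v)^* : R[i]^o).
Proof.
have conjE (c w : R[i]) : (c *: (w^* : R[i]^o))^* = c^* * w.
  by rewrite rmorphM /= conjCK.
rewrite /lift /free_lift; apply: respects_cyclic => [s1 s2 a x y|x s].
  rewrite !rmorph_sum /= scaler_sumr -big_split /=; apply: eq_bigr => t _.
  by rewrite !conjE (cyc_wordPl t) mulrDr [in RHS]/GRing.scale /= mulrCA.
by congr (_^*); apply: eq_bigr => t _; rewrite cyc_word_rot.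
Qed.

Lemma cyc_dotPl v a u1 u2 :
  cyc_dot (a *: u1 + u2) v = a * cyc_dot u1 v + cyc_dot u2 v.
Proof. exact: (lift_is_linear (@cyc_dot_respects v)). Qed.

Lemma cyc_dot_circularl s v : cyc_dot (circular s) v =
  (lift (fun t => (cyc_word s t)^* : R[i]^o) v)^*.
Proof. exact: (lift_gen (@cyc_dot_respects v)). Qed.

Lemma cyc_dotE s t : cyc_dot (circular s) (circular t) = cyc_word s t.
Proof.
by rewrite cyc_dot_circularl (lift_gen (@cyc_word_respects s)) conjCK.
Qed.

Lemma cyc_dotPr u a v1 v2 :
  cyc_dot u (a *: v1 + v2) = a^* * cyc_dot u v1 + cyc_dot u v2.
Proof.
rewrite /cyc_dot {1 3 5}/lift /free_lift mulr_sumr -big_split /=.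
apply: eq_bigr => s _.
rewrite (lift_is_linear (@cyc_word_respects s)) rmorphD rmorphM /=.
by rewrite /GRing.scale /= mulrDr mulrCA.
Qed.

End Fock.

Section RandomMatrices.
Variables (R : realType) (d : measure_display) (T : measurableType d).
Variable P : probability T R.

Definition cexpect (Z : T -> R[i]) : R[i] :=
  fine 'E_P[fun t => complex.Re (Z t)] +i* fine 'E_P[fun t => complex.Im (Z t)].

Definition k2 (A B : T -> R[i]) : R[i] :=
  cexpect (fun t => A t * B t) - cexpect A * cexpect B.

(* The Dirac mass is the case of variance 0; [normal_prob 0 0] is instead the
   uniform law on [0, 1]. *)
Definition centered_gaussian (Y : T -> R) : Prop :=
  measurable_fun setT Y /\
  exists2 s : R, 0 <= s & forall A : set R, measurable A ->
    P (Y @^-1` A) = if s == 0 then \d_(0 : R) A else normal_prob 0 s A.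

(* Joint Gaussianity of the real and imaginary parts, as Gaussianity of all
   their finite real linear combinations. *)
Definition centered_gaussian_family (J : Type) (Z : J -> T -> R[i]) : Prop :=
  forall (s : seq J) (a b : J -> R), centered_gaussian (fun t =>
    \sum_(j <- s) (a j * complex.Re (Z j t) + b j * complex.Im (Z j t))).

Definition hermitian_gaussian (H : lmodType R) (dot : {dot H for idfun})
    (N : nat) (X : H -> T -> 'M[R[i]]_N) : Prop :=
  [/\ forall f t i j, X f t i j = (X f t j i)^*,
      centered_gaussian_family
        (fun (u : 'I_N * 'I_N * H) t => X u.2 t u.1.1 u.1.2),
      forall f g (i j k l : 'I_N), (i < j)%N -> (k < l)%N ->
        cexpect (fun t => X f t i j * X g t k l) = 0
    & forall f g (i j k l : 'I_N), (i <= j)%N -> (k <= l)%N ->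
        cexpect (fun t => X f t i j * (X g t k l)^*) =
        (i == k)%:R * (j == l)%:R * (N%:R^-1 * dot f g)%:C].

End RandomMatrices.

(* Main.v *)
Require Import Defs.
From HB Require Import structures.
From mathcomp Require Import all_boot all_order all_algebra.
From mathcomp Require Import complex ring lra zify.
From mathcomp Require Import all_classical all_reals all_analysis.
From mathcomp Require Import measurable_realfun.
Import Order.TTheory GRing.Theory Num.Theory numFieldNormedType.Exports.
Local Open Scope classical_set_scope.
Local Open Scope complex_scope.
Local Open Scope ring_scope.

Set Implicit Arguments.
Unset Strict Implicit.
Unset Printing Implicit Defensive.

(** Both sides of the limit obey the same recursion on the first word.

    On the matrix side, Gaussian integration by parts turns the first factor of
    [Tr X(f) X_w] into a derivation.  Contracting [X(f)] with a letter [h] of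
    [w = a h c] splits the trace into [Tr X_a Tr X_c], and contracting it with a
    letter of another trace [Tr X_v], [v = a h c], merges the two traces into
    [Tr X_c X_a X_w]; each contraction costs a factor [<f, h> / N].  For the
    means of the normalized traces and for the joint moments of the centered
    traces this is a closed system of equations
    ([gaussian_loop_equations]).  It shows, by induction on the total length of
    the words, that all these quantities converge ([loop_converge]).  Hence the
    terms with a factor [1 / N] drop out in the limit, and what remains for the
    limits [tau] of the means and [K] of the covariances is
      [tau (f w) = sum_(w = a h c) <f, h> tau a tau c]
    and
      [K (f w) v = sum_(w = a h c) <f, h> (tau a K c v + tau c K a v)
                 + sum_(v = a h c) <f, h> tau (c a w)],
    which together with [tau 1 = 1] and [K 1 v = 0] determine [tau] and [K]
    ([cvg_loop_m], [cvg_loop_c]).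

    On the Fock side the vector [omega(f_1) .. omega(f_n) Omega] is a
    combination of tensors of subwords: some letters stay open, the others are
    contracted in pairs without crossings.  The scalar [tau] is the vacuum
    coefficient.  If [f] is annihilated by a letter [h] of [w = a h c], the
    letters of [a] can only be contracted among themselves, whence the
    coefficient [tau a]; symmetrically, [cmap] contracts [f] with an open
    letter [h] from the right, which leaves [tau c].  This gives the first sum of
    the recursion for the covariance ([wick_cyclic_recursion]).  If [f] stays
    open, the cyclic inner product pairs it with an open letter [h] of the other
    vector; cutting the circle at [h] leaves the linear inner product of
    [omega(w) Omega] with the vector of the rotated word [c a]
    ([wick_cyclic_derivative]), and this inner product is a value of [tau]
    because the operators [omega] are symmetric ([wick_pairing]).  This is the
    second sum ([fock_covariance_cons]).

    Integration by parts itself is deduced from the moments of a single Gaussian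
    variable: [E Y^(p+1) = p E Y^2 E Y^(p-1)] is integration by parts against
    the normal density ([integral_power_normal_pdf]), and applying it to all
    linear combinations of the entries and comparing coefficients, that is
    polarizing, gives the joint moments ([isserlis]). *)

(** * Sums over the cuts of a word *)

Section Cuts.
Variable H : Type.

(** A sum over all factorizations [w = a x c]; recursion on [w] makes the
    splitting of the first letter a computation. *)
Fixpoint cuts (V : nmodType) (G : seq H -> H -> seq H -> V) (w : seq H) : V :=
  if w is h :: w' then G [::] h w' + cuts (fun a x c => G (h :: a) x c) w'
  else 0.

(** The general principle behind the compatibilities of [cuts] with additive
    structure. *)
Lemma cuts_rel (V V' : nmodType) (K : V -> V' -> Prop)
    (G : seq H -> H -> seq H -> V) (G' : seq H -> H -> seq H -> V') w :
  K 0 0 -> (forall x x' y y', K x x' -> K y y' -> K (x + y) (x' + y')) ->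
  (forall a x c, w = a ++ x :: c -> K (G a x c) (G' a x c)) ->
  K (cuts G w) (cuts G' w).
Proof.
move=> K0 KD; elim: w G G' => [//|h w ih] G G' KG /=.
apply: KD; first exact: KG.
by apply: ih => a x c e; apply: KG; rewrite e.
Qed.

Lemma eq_cuts (V : nmodType) (G G' : seq H -> H -> seq H -> V) w :
  (forall a x c, w = a ++ x :: c -> G a x c = G' a x c) ->
  cuts G w = cuts G' w.
Proof.
move=> e; apply: (cuts_rel (K := fun x y => x = y)) => //.
by move=> x x' y y' -> ->.
Qed.

Lemma cutsD (V : nmodType) (G G' : seq H -> H -> seq H -> V) w :
  cuts (fun a x c => G a x c + G' a x c) w = cuts G w + cuts G' w.
Proof.
by elim: w G G' => [|h w ih] G G' /=; rewrite ?addr0// ih addrACA.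
Qed.

Lemma cutsM (F : pzSemiRingType) (G : seq H -> H -> seq H -> F) k w :
  cuts (fun a x c => k * G a x c) w = k * cuts G w.
Proof.
apply: (cuts_rel (K := fun x y => x = k * y)) => //; first by rewrite mulr0.
by move=> x x' y y' -> ->; rewrite mulrDr.
Qed.

Lemma cutsMr (F : pzSemiRingType) (G : seq H -> H -> seq H -> F) k w :
  cuts (fun a x c => G a x c * k) w = cuts G w * k.
Proof.
apply: (cuts_rel (K := fun x y => x = y * k)) => //; first by rewrite mul0r.
by move=> x x' y y' -> ->; rewrite mulrDl.
Qed.

Lemma cuts0 (V : nmodType) w : cuts (fun _ _ _ => 0 : V) w = 0.
Proof. by elim: w => //= h w ->; rewrite addr0. Qed.

Lemma sum_cuts (V : nmodType) (I : Type) (r : seq I)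
    (G : I -> seq H -> H -> seq H -> V) w :
  \sum_(i <- r) cuts (G i) w = cuts (fun a x c => \sum_(i <- r) G i a x c) w.
Proof.
elim: r => [|i r ih].
  by rewrite big_nil; under eq_cuts do rewrite big_nil; rewrite cuts0.
by rewrite big_cons ih; under [in RHS]eq_cuts do rewrite big_cons; rewrite cutsD.
Qed.

(** Both sides range over the factorizations [w = a k a' k' c]: the letter that
    is cut out first may be the left or the right one. *)
Lemma exchange_cuts (V : nmodType)
    (G : seq H -> H -> seq H -> H -> seq H -> V) w :
  cuts (fun a k c => cuts (fun a' k' c' => G a k a' k' c') c) w =
  cuts (fun a k' c' => cuts (fun a1 k a' => G a1 k a' k' c') a) w.
Proof.
elim: w G => [//|h w ih] G /=.
by rewrite add0r (ih (fun a k a' k' c => G (h :: a) k a' k' c)) -cutsD.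
Qed.

Lemma cuts_cat (V : nmodType) (G : seq H -> H -> seq H -> V) u v :
  cuts G (u ++ v) = cuts (fun a x c => G a x (c ++ v)) u +
                    cuts (fun a x c => G (u ++ a) x c) v.
Proof. by elim: u G => [|h u ih] G /=; rewrite ?add0r// ih addrA. Qed.

Lemma cuts_rev (V : nmodType) (G : seq H -> H -> seq H -> V) w :
  cuts G (rev w) = cuts (fun a x c => G (rev c) x (rev a)) w.
Proof.
elim: w G => [//|h w ih] G; rewrite rev_cons -cats1 cuts_cat ih /= addr0 addrC.
rewrite cats0; congr (_ + _); apply: eq_cuts => a x c _.
by rewrite rev_cons cats1.
Qed.

Lemma cuts_ord (V : nmodType) (G : seq H -> H -> seq H -> V) x0 w :
  cuts G w = \sum_(k < size w) G (take k w) (nth x0 w k) (drop k.+1 w).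
Proof.
elim: w G => [|h w ih] G /=; first by rewrite big_ord0.
by rewrite big_ord_recl /= drop0 ih.
Qed.

End Cuts.

(** * Expansion of words in the field operators *)

Section WickExpansion.
Variables (F : comNzRingType) (H : Type) (b : H -> H -> F).
Hypothesis bC : forall x y, b x y = b y x.
Implicit Types (phi psi : seq H -> F) (u v w s t : seq H).

(** The functionals of this section stand for linear forms on the Fock space,
    given by their values on tensors: [contract f phi] is the composite of [phi]
    with the annihilation operator of [f], and [rcontract f phi] the composite
    with the annihilation operator acting on the last factor. *)
Definition contract f phi s := if s is g :: s' then b f g * phi s' else 0.

Definition rcontract f phi s :=
  if rev s is g :: s' then b f g * phi (rev s') else 0.

(** The composite of [phi] with [omega f]. *)
Definition dual_field f phi s := phi (f :: s) + contract f phi s.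

(** The value of [phi] at [omega f_1 .. omega f_n Omega]: moving the operators
    over to the form avoids naming vectors of the Fock space. *)
Fixpoint wick phi w := if w is f :: w' then wick (dual_field f phi) w' else phi [::].

(** The vacuum coefficient, i.e. the moments of the semicircular family. *)
Definition tau w := wick (fun s => (nilp s)%:R) w.

Lemma eq_wick phi psi w : phi =1 psi -> wick phi w = wick psi w.
Proof. by move=> /funext ->. Qed.

Lemma dual_fieldP f k phi psi s : dual_field f (fun s => k * phi s + psi s) s =
  k * dual_field f phi s + dual_field f psi s.
Proof. by case: s => [|g s]; rewrite /dual_field/=; ring. Qed.

Lemma wickP k phi psi w :
  wick (fun s => k * phi s + psi s) w = k * wick phi w + wick psi w.
Proof.
elim: w phi psi => [//|f w ih] phi psi /=; rewrite -ih.
by apply: eq_wick => s; exact: dual_fieldP.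
Qed.

Lemma wickD phi psi w :
  wick (fun s => phi s + psi s) w = wick phi w + wick psi w.
Proof.
by rewrite -[wick phi w]mul1r -wickP; apply: eq_wick => s; rewrite mul1r.
Qed.

Lemma wick0 w : wick (fun=> 0) w = 0.
Proof.
elim: w => //= f w ih; rewrite -[RHS]ih; apply: eq_wick.
by case=> [|g s]; rewrite /dual_field /= ?mulr0 addr0.
Qed.

Lemma wickM k phi w : wick (fun s => k * phi s) w = k * wick phi w.
Proof.
rewrite -[RHS]addr0 -[0 in RHS](wick0 w) -wickP.
by apply: eq_wick => s; rewrite addr0.
Qed.

Lemma wick_nil k w : wick (fun s => (nilp s)%:R * k) w = tau w * k.
Proof.
by rewrite mulrC -wickM; apply: eq_wick => s; rewrite mulrC.
Qed.

Lemma wick_dual_field f (phi : seq H -> seq H -> F) s w :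
  wick (fun t => dual_field f (phi^~ t) s) w = dual_field f (fun s => wick (phi s) w) s.
Proof. by rewrite /dual_field wickD; case: s => [|g s] /=; rewrite ?wick0 ?wickM. Qed.

Lemma exchange_wick (phi : seq H -> seq H -> F) u w :
  wick (fun s => wick (phi s) w) u = wick (fun t => wick (phi^~ t) u) w.
Proof.
elim: u phi => [//|f u ih] phi /=; rewrite -ih.
by apply: eq_wick => s; rewrite wick_dual_field.
Qed.

Lemma wick_cuts (G : seq H -> H -> seq H -> seq H -> F) u w :
  wick (fun s => cuts (fun a x c => G a x c s) u) w =
  cuts (fun a x c => wick (G a x c) w) u.
Proof.
elim: u G => [|h u ih] G /=; first exact: wick0.
by rewrite wickD ih.
Qed.

Lemma size_cutl a x c w n :
  w = a ++ x :: c -> (size w <= n)%N -> (size a < n)%N.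
Proof.
by move=> ->; apply: leq_trans; rewrite size_cat /= -addSnnS leq_addr.
Qed.

Lemma size_cutr a x c w n :
  w = a ++ x :: c -> (size w <= n)%N -> (size c < n)%N.
Proof. by move=> ->; apply: leq_trans; rewrite size_cat /= leq_addl. Qed.

(** When [f] annihilates the open letter [h] of [w = a h c], nothing in [a] may
    stay open, so that [a] contributes the scalar [tau a]. *)
Lemma wick_contract f phi w : wick (contract f phi) w =
  cuts (fun a h c => b f h * (tau a * wick phi c)) w.
Proof.
have [n] := ubnP (size w); elim: n w f phi => // n ih [|h w] f phi //= le_n.
rewrite /dual_field wickD /= wickM ih// /tau /= mul1r; congr (_ + _).
under eq_cuts => a k c e do
  rewrite (ih c _ _ (size_cutr e (ltnW le_n))) mulrA -cutsM.
(* [f] is annihilated after [h] has been, so that the contraction of [f] encloses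
   that of [h]; the enclosed words build up one value of [tau]. *)
rewrite exchange_cuts; apply: eq_cuts => a k c e.
have -> : wick (dual_field h (fun s => (nilp s)%:R)) a =
    wick (contract h (fun s => (nilp s)%:R)) a.
  by apply: eq_wick => s; rewrite /dual_field add0r.
rewrite (ih a _ _ (size_cutl e (ltnW le_n))).
rewrite [RHS]mulrCA [RHS]mulrC -[RHS]cutsM.
by apply: eq_cuts => a1 x c1 _; rewrite /tau; ring.
Qed.

Lemma tau_cons f w :
  tau (f :: w) = cuts (fun a h c => b f h * (tau a * tau c)) w.
Proof.
rewrite /tau /= -/(tau _) -wick_contract.
by apply: eq_wick => s; rewrite /dual_field add0r.
Qed.

Lemma rcontract_rcons f phi s g : rcontract f phi (rcons s g) = b f g * phi s.
Proof. by rewrite /rcontract rev_rcons revK. Qed.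

Lemma dual_field_rcontract f h phi s : dual_field h (rcontract f phi) s =
  b f h * ((nilp s)%:R * phi [::]) + rcontract f (dual_field h phi) s.
Proof.
case/lastP: s => [|[|y s] x].
- by rewrite /dual_field /rcontract /rev /=; ring.
- by rewrite /dual_field /rcontract /rev /=; ring.
- rewrite /dual_field /= -!rcons_cons !rcontract_rcons /=.
  by ring.
Qed.

(** Mirror image of [wick_contract].  Right annihilation commutes with each
    [omega h], except on the vacuum ([dual_field_rcontract]), so that an induction
    on the word suffices. *)
Lemma wick_rcontract f phi w : wick (rcontract f phi) w =
  cuts (fun a h c => b f h * (tau c * wick phi a)) w.
Proof.
elim: w phi => [//|h w ih] phi /=.
under eq_wick do rewrite dual_field_rcontract.
by rewrite wickP wick_nil ih.
Qed.

(** A letter [h] in the middle of a word either stays open or is contracted with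
    a letter on its left or on its right; in the latter cases the letters between
    the two ends of the contraction are contracted among themselves. *)
Lemma wick_insert phi v h w : wick phi (v ++ h :: w) =
  wick (fun s => wick (fun t => phi (s ++ h :: t)) w) v +
  cuts (fun a k c => b h k * (tau c * wick phi (a ++ w))) v +
  cuts (fun a k c => b h k * (tau a * wick phi (v ++ c))) w.
Proof.
elim: v phi => [|f v ih] phi /=.
  by rewrite addr0 /dual_field wickD wick_contract.
rewrite ih /=.
have -> : wick (fun s => wick (fun t => dual_field f phi (s ++ h :: t)) w) v =
    b h f * (tau v * wick phi w) +
    wick (dual_field f (fun s => wick (fun t => phi (s ++ h :: t)) w)) v.
  rewrite -wick_nil -wickP; apply: eq_wick => s.
  rewrite -wick_dual_field.
  case: s => [|y s] /=; last by rewrite mul0r mulr0 add0r.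
  rewrite mul1r -wickP; apply: eq_wick => t.
  by rewrite /dual_field /= addr0 [RHS]addrC bC.
by rewrite -!addrA addrCA.
Qed.

(** Selecting one open letter [x] cuts the word at [x], and the letters on
    either side of the cut are then contracted independently, as no contraction
    may cross an open letter. *)
Lemma wick_cut f (psi : seq H -> seq H -> F) w :
  wick (cuts (fun a x c => b f x * psi a c)) w =
  cuts (fun a x c => b f x * wick (fun s => wick (psi s) c) a) w.
Proof.
elim: w psi => [//|h w ih] psi /=.
have E s : dual_field h (cuts (fun a x c => b f x * psi a c)) s = b f h * psi [::] s +
    cuts (fun a x c => b f x * dual_field h (psi^~ c) a) s.
  rewrite /dual_field /= -addrA; congr (_ + _).
  under [in RHS]eq_cuts do rewrite mulrDr.
  rewrite cutsD; congr (_ + _).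
  case: s => [//|y s] /=; rewrite mulr0 add0r -cutsM.
  by apply: eq_cuts => a x c _; rewrite mulrCA.
under eq_wick do rewrite E.
rewrite wickP ih; congr (_ + _); apply: eq_cuts => a x c _; congr (_ * _).
by apply: eq_wick => s; rewrite wick_dual_field.
Qed.

(** The recursion that defines [cmap] on tensors, with [phi] for the values on
    circular tensors and [kappa] for the values of the composite with [cmap]. *)
Definition cyclic_recursion phi (kappa : seq H -> F) : Prop :=
  (kappa [::] = 0) /\
  (forall f s, kappa (f :: s) = phi (f :: s) + rcontract f kappa s).

(** Either [f] remains in the circular tensor, or it is contracted with a letter
    [h] of [w = a h c], by [omega f] from the left or by [cmap] from the
    right.  One of the arcs [a] and [c] of the circle is then closed off by the
    contraction, the other one carries the circular tensor. *)
Lemma wick_cyclic_recursion phi kappa f w : cyclic_recursion phi kappa ->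
  wick kappa (f :: w) = wick (fun s => phi (f :: s)) w +
    cuts (fun a h c => b f h * (tau a * wick kappa c + tau c * wick kappa a)) w.
Proof.
move=> [_ kE] /=; rewrite /dual_field wickD wick_contract.
under eq_wick do rewrite kE.
rewrite wickD wick_rcontract -addrA -cutsD; congr (_ + _).
by apply: eq_cuts => a h c _; rewrite mulrDr addrC.
Qed.

(** Differentiating the image under [cmap] of [omega v Omega] in the direction [f]:
    if [phi] removes a letter from the circle and reads the rest linearly from
    there on, then the outcome for [v = a h c] is the full expansion of the
    rotated word [c a].  The contractions made by [cmap] between both ends of the
    word become the ordinary contractions between [c] and [a]. *)
Lemma wick_cyclic_derivative f psi phi kappa v : cyclic_recursion phi kappa ->
  (forall t, phi t = cuts (fun a x c => b f x * psi (c ++ a)) t) ->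
  wick kappa v = cuts (fun a x c => b f x * wick psi (c ++ a)) v.
Proof.
move=> kR phiE; have [n] := ubnP (size v).
elim: n v => // n ih [|h w] le_n; first by case: kR.
rewrite (wick_cyclic_recursion _ _ kR) /= cats0.
under eq_wick do rewrite phiE /= cats0.
rewrite wickP -addrA; congr (_ + _).
rewrite (wick_cut f (fun s t => psi (t ++ h :: s))).
under [in RHS]eq_cuts do rewrite wick_insert !mulrDr.
rewrite 2!cutsD -addrA; congr (_ + _).
  by apply: eq_cuts => a x c _; rewrite exchange_wick.
(* The two remaining sums are the contractions of [h], in the rotated word, with
   a letter on its left and with a letter on its right. *)
under eq_cuts do rewrite mulrDr.
rewrite cutsD addrC; congr (_ + _).
  transitivity (cuts (fun a k c => cuts (fun a' x c' =>
      b h k * tau c * (b f x * wick psi (c' ++ a'))) a) w).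
    apply: eq_cuts => a k c e.
    by rewrite cutsM -(ih a (size_cutl e (ltnW le_n))) mulrA.
  rewrite -exchange_cuts; apply: eq_cuts => a x c _.
  by rewrite -cutsM; apply: eq_cuts => a' k c' _; ring.
transitivity (cuts (fun a k c => cuts (fun a' x c' =>
    b h k * tau a * (b f x * wick psi (c' ++ a'))) c) w).
  apply: eq_cuts => a k c e.
  by rewrite cutsM -(ih c (size_cutr e (ltnW le_n))) mulrA.
rewrite exchange_cuts; apply: eq_cuts => a x c _.
by rewrite -cutsM; apply: eq_cuts => a' k c' _; ring.
Qed.

Fixpoint pairing s t := match s, t with
  | [::], [::] => 1
  | x :: s', y :: t' => b x y * pairing s' t'
  | _, _ => 0
  end.

(** The field operators are symmetric, so that those of the second vector can be
    moved over to the first one, where they appear in reverse order. *)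
Lemma wick_pairing u w :
  wick (fun s => wick (pairing s) u) w = tau (rev u ++ w).
Proof.
elim: u w => [|h u ih] w /=.
  by apply: eq_wick; case.
rewrite rev_cons cat_rcons -ih /=; apply: eq_wick => s.
rewrite -wick_dual_field; apply: eq_wick => t.
rewrite /dual_field addrC; congr (_ + _).
by case: s => //= x s; rewrite bC.
Qed.

End WickExpansion.

(** * The loop equations and their limit *)

Section LargeDimension.
Variables (C : numFieldType) (H : Type) (b : H -> H -> C).

Definition selections (V : nmodType)
    (G : seq H -> seq (seq H) -> V) (ws : seq (seq H)) : V :=
  cuts (fun vs v vs' => G v (vs ++ vs')) ws.

(** The equations for a fixed dimension [N = 1 / e]: [m w] stands for the mean of
    [Tr X_w / N], and [c ws] for the mean of the product of the centered traces
    [Tr X_w - E Tr X_w], [w] in [ws]. *)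
Record loop_equations (e : C) (m : seq H -> C) (c : seq (seq H) -> C) : Prop :=
  LoopEquations {
  loop_m0 : m [::] = 1;
  loop_mS : forall f w, m (f :: w) = cuts (fun a h x =>
    b f h * (m a * m x + e ^+ 2 * c [:: a; x])) w;
  loop_c0 : c [::] = 1;
  loop_c0S : forall ws, c ([::] :: ws) = 0;
  loop_cS : forall f w ws, c ((f :: w) :: ws) =
    cuts (fun a h x => b f h *
      (e * (c [:: a, x & ws] - c [:: a; x] * c ws) +
       m a * c (x :: ws) + m x * c (a :: ws))) w +
    selections (fun v vs => cuts (fun a h x => b f h *
      (e * c ((x ++ a ++ w) :: vs) + m (x ++ a ++ w) * c vs)) v) ws }.

Lemma cvg_cuts (I : Type) (G : nat -> seq I -> I -> seq I -> C)
    (l : seq I -> I -> seq I -> C) w :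
  (forall a x c, w = a ++ x :: c -> G N a x c @[N --> \oo] --> l a x c) ->
  cuts (G N) w @[N --> \oo] --> cuts l w.
Proof.
elim: w G l => [|h w ih] G l Gl /=; first exact: cvg_cst.
apply: cvgD; first exact: Gl.
apply: (ih (fun N a x c => G N (h :: a) x c)) => a x c e.
by apply: Gl; rewrite e.
Qed.

Variables (e : nat -> C) (m : nat -> seq H -> C) (c : nat -> seq (seq H) -> C).
Hypothesis e0 : e N @[N --> \oo] --> (0 : C).
Hypothesis loops : forall N, loop_equations (e N) (m N) (c N).

(** The right hand sides involve only words of total length at least 2 less than
    the left hand sides. *)
Lemma loop_converge n :
  (forall ws, (size (flatten ws) < n)%N ->
    exists l : C, c N ws @[N --> \oo] --> l) /\
  (forall w, (size w < n)%N -> exists l : C, m N w @[N --> \oo] --> l).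
Proof.
elim: n => [|n [ihc ihm]]; first by [].
have cvg_ex (u : nat -> C) : (exists l : C, u N @[N --> \oo] --> l) <->
    cvgn u by split => [[l]|] h; [apply/cvg_ex; exists l|exists (limn u)].
have {}ihc ws : (size (flatten ws) < n)%N -> cvgn (c^~ ws).
  by move=> /ihc/cvg_ex.
have {}ihm w : (size w < n)%N -> cvgn (m^~ w) by move=> /ihm/cvg_ex.
have cuts_ex (I : Type) (G : nat -> seq I -> I -> seq I -> C) w :
    (forall a x c, w = a ++ x :: c -> cvgn (fun N => G N a x c)) ->
    cvgn (fun N => cuts (G N) w).
  move=> Gl; apply/cvg_ex.
  exists (cuts (fun a x c => limn (fun N => G N a x c)) w).
  exact: cvg_cuts.
have ex_e : cvgn e by apply/cvg_ex; exists 0.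
split=> [[|[|f w] ws]|[|f w]] lt_n; apply/cvg_ex.
- under eq_fun do rewrite (loop_c0 (loops _)); exact: is_cvg_cst.
- under eq_fun do rewrite (loop_c0S (loops _)); exact: is_cvg_cst.
- under eq_fun do rewrite (loop_cS (loops _)).
  apply: is_cvgD; last first.
    apply: (@cuts_ex) => vs1 v vs2 E.
    apply: (@cuts_ex) => a1 h1 x1 E1; apply: is_cvgM; first exact: is_cvg_cst.
    move: lt_n; rewrite E E1 /= !flatten_cat /= !size_cat /= => lt_n.
    apply: is_cvgD; apply: is_cvgM; first exact: ex_e.
    - by apply: ihc; rewrite /= !flatten_cat !size_cat; lia.
    - by apply: ihm; rewrite !size_cat; lia.
    - by apply: ihc; rewrite flatten_cat !size_cat; lia.
  apply: (@cuts_ex) => a h x E; apply: is_cvgM; first exact: is_cvg_cst.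
  move: lt_n; rewrite E /= !size_cat /= => lt_n.
  apply: is_cvgD; first (apply: is_cvgD; apply: is_cvgM; first exact: ex_e).
  - apply: is_cvgB; last apply: is_cvgM.
    + by apply: ihc; rewrite /= !size_cat; lia.
    + by apply: ihc; rewrite /= cats0 !size_cat; lia.
    + by apply: ihc; lia.
  - by apply: ihm; lia.
  - by apply: ihc; rewrite /= size_cat; lia.
  - apply: is_cvgM; first by apply: ihm; lia.
    by apply: ihc; rewrite /= size_cat; lia.
- under eq_fun do rewrite (loop_m0 (loops _)); exact: is_cvg_cst.
- under eq_fun do rewrite (loop_mS (loops _)).
  apply: (@cuts_ex) => a h x E; apply: is_cvgM; first exact: is_cvg_cst.
  move: lt_n; rewrite E /= !size_cat /= => lt_n.
  apply: is_cvgD; apply: is_cvgM.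
  - by apply: ihm; lia.
  - by apply: ihm; lia.
  - by apply: is_cvgM; exact: ex_e.
  - by apply: ihc; rewrite /= cats0 size_cat; lia.
Qed.

Lemma cvg_e_loop ws : e N * c N ws @[N --> \oo] --> (0 : C).
Proof.
have [/(_ ws (leqnn _))[l cl] _] := loop_converge (size (flatten ws)).+1.
by rewrite -[0](mul0r l); exact: cvgM.
Qed.

Lemma cvg_loop_m w : m N w @[N --> \oo] --> tau b w.
Proof.
have [n] := ubnP (size w); elim: n w => // n ih [|f w] le_n.
  by under eq_fun do rewrite (loop_m0 (loops _)); exact: cvg_cst.
under eq_fun do rewrite (loop_mS (loops _)).
rewrite tau_cons; apply: cvg_cuts => a h x E.
apply: cvgM; first exact: cvg_cst.
rewrite -[tau b a * _]addr0; apply: cvgD.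
  by apply: cvgM; apply: ih; move: le_n; rewrite E /= size_cat /=; lia.
rewrite -[0](mul0r 0); under eq_fun do rewrite expr2 -mulrA.
by apply: cvgM => //; exact: cvg_e_loop.
Qed.

Lemma cvg_loop_c (K : seq H -> seq H -> C) u v :
  (forall v, K [::] v = 0) ->
  (forall f w v, K (f :: w) v =
    cuts (fun a h x => b f h * (tau b a * K x v + tau b x * K a v)) w +
    cuts (fun a h x => b f h * tau b (x ++ a ++ w)) v) ->
  c N [:: u; v] @[N --> \oo] --> K u v.
Proof.
move=> K0 KS; have [n] := ubnP (size u); elim: n u => // n ih [|f w] le_n.
  by under eq_fun do rewrite (loop_c0S (loops _)); rewrite K0; exact: cvg_cst.
under eq_fun do rewrite (loop_cS (loops _)).
rewrite KS; apply: cvgD.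
  apply: cvg_cuts => a h x E; apply: cvgM; first exact: cvg_cst.
  rewrite -[tau b a * _]add0r; apply: cvgD; last first.
    apply: cvgM; first exact: cvg_loop_m.
    by apply: ih; move: le_n; rewrite E /= size_cat /=; lia.
  apply: cvgD; last first.
    apply: cvgM; first exact: cvg_loop_m.
    by apply: ih; move: le_n; rewrite E /= size_cat /=; lia.
  under eq_fun do rewrite mulrBr mulrA.
  have [/(_ [:: v] (leqnn _))[l cl] _] := loop_converge (size (flatten [:: v])).+1.
  rewrite -[0](subrr 0) -[X in _ - X](mul0r l); apply: cvgB.
    exact: cvg_e_loop.
  by apply: cvgM => //; exact: cvg_e_loop.
under eq_fun do rewrite /selections /= addr0.
apply: cvg_cuts => a h x _; apply: cvgM; first exact: cvg_cst.
rewrite -[tau b _]add0r; apply: cvgD; first exact: cvg_e_loop.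
under eq_fun do rewrite (loop_c0 (loops _)) mulr1.
exact: cvg_loop_m.
Qed.

End LargeDimension.

(** * Gaussian integration by parts *)

Section Expectation.
Variables (C : numFieldType) (T : Type).

(** A normalized linear functional on an algebra of functions; [good] plays the
    role of the algebra of random variables with moments of all orders. *)
Record expectation_functional (E : (T -> C) -> C) (good : (T -> C) -> Prop) : Prop :=
  ExpectationFunctional {
  good_cst : forall k, good (fun=> k);
  goodD : forall f g, good f -> good g -> good (fun t => f t + g t);
  goodM : forall f g, good f -> good g -> good (fun t => f t * g t);
  expect_cst : forall k, E (fun=> k) = k;
  expectD : forall f g, good f -> good g -> E (fun t => f t + g t) = E f + E g;
  expectM : forall k f, good f -> E (fun t => k * f t) = k * E f }.

Variables (E : (T -> C) -> C) (good : (T -> C) -> Prop).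
Hypothesis ax : expectation_functional E good.
Implicit Types (f g A Y Z : T -> C) (ys : seq (T -> C)).

Lemma goodZ k f : good f -> good (fun t => k * f t).
Proof. by move=> gf; apply: (goodM ax) => //; exact: (good_cst ax). Qed.

Lemma goodX f n : good f -> good (fun t => f t ^+ n).
Proof.
move=> gf; elim: n => [|n ih].
  by under eq_fun do rewrite expr0; exact: (good_cst ax).
by under eq_fun do rewrite exprS; exact: (goodM ax).
Qed.

Lemma good_sum I (r : seq I) (F : I -> T -> C) :
  (forall i, good (F i)) -> good (fun t => \sum_(i <- r) F i t).
Proof.
move=> gF; elim: r => [|i r ih].
  by under eq_fun do rewrite big_nil; exact: (good_cst ax).
by under eq_fun do rewrite big_cons; exact: (goodD ax).
Qed.

Lemma expect_sum I (r : seq I) (F : I -> T -> C) : (forall i, good (F i)) ->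
  E (fun t => \sum_(i <- r) F i t) = \sum_(i <- r) E (F i).
Proof.
move=> gF; elim: r => [|i r ih].
  by under eq_fun do rewrite big_nil; rewrite (expect_cst ax) big_nil.
under eq_fun do rewrite big_cons.
by rewrite (expectD ax) ?big_cons ?ih//; exact: good_sum.
Qed.

Lemma good_cuts I (G : seq I -> I -> seq I -> T -> C) w :
  (forall a x c, w = a ++ x :: c -> good (G a x c)) ->
  good (fun t => cuts (fun a x c => G a x c t) w).
Proof.
elim: w G => [|h w ih] G gG /=; first exact: (good_cst ax).
apply: (goodD ax); first exact: gG.
by apply: (ih (fun a => G (h :: a))) => a x c e; apply: gG; rewrite e.
Qed.

Lemma expect_cuts I (G : seq I -> I -> seq I -> T -> C) w :
  (forall a x c, w = a ++ x :: c -> good (G a x c)) ->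
  E (fun t => cuts (fun a x c => G a x c t) w) =
  cuts (fun a x c => E (G a x c)) w.
Proof.
elim: w G => [|h w ih] G gG /=; first exact: (expect_cst ax).
have gG' a x c : w = a ++ x :: c -> good (G (h :: a) x c).
  by move=> e; apply: gG; rewrite e.
rewrite (expectD ax) ?ih//; first exact: gG.
exact: (good_cuts (G := fun a => G (h :: a))).
Qed.

(** Polarization: expectations of powers of [Y + t Z] are polynomials in [t], so
    that identities between them can be compared coefficientwise; the coefficient
    of degree 1 replaces one factor [Y] by [Z]. *)
Lemma expect_power_poly A Y Z p : good A -> good Y -> good Z ->
  exists q : {poly C}, [/\ forall t, E (fun x => A x * (Y x + t * Z x) ^+ p) = q.[t],
    q`_0 = E (fun x => A x * Y x ^+ p) &
    q`_1 = p%:R * E (fun x => A x * Z x * Y x ^+ p.-1)].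
Proof.
move=> + gY gZ; elim: p A => [|p ih] A gA.
  exists (E A)%:P; split=> [t||]; last by rewrite coefC mul0r.
    by rewrite hornerC; under eq_fun do rewrite expr0 mulr1.
  by rewrite coefC; under eq_fun do rewrite expr0 mulr1.
have [q [qE q0 q1]] := ih _ (goodM ax gA gY).
have [r [rE r0 r1]] := ih _ (goodM ax gA gZ).
exists (q + 'X * r); split=> [t||].
- rewrite hornerD hornerM hornerX -qE -rE.
  have gP : good (fun x => (Y x + t * Z x) ^+ p).
    exact/goodX/(goodD ax gY)/goodZ.
  rewrite -(expectM ax); last exact/(goodM ax _ gP)/(goodM ax).
  rewrite -(expectD ax); first by apply: congr1; apply/funext => x; rewrite exprS; ring.
    exact/(goodM ax _ gP)/(goodM ax).
  exact/goodZ/(goodM ax _ gP)/(goodM ax).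
- rewrite coefD coefXM addr0 q0; apply: congr1; apply/funext => x.
  by rewrite exprS mulrA.
- rewrite coefD coefXM /= q1 r0 -natr1 mulrDl mul1r; congr (_ + _).
  case: p {ih q qE q0 q1 r rE r0 r1} => [|p]; first by rewrite !mul0r.
  by congr (_ * _); apply: congr1; apply/funext => x; rewrite exprS /=; ring.
Qed.

Lemma eq_poly_nat (q r : {poly C}) : (forall n : nat, q.[n%:R] = r.[n%:R]) -> q = r.
Proof.
move=> qr; apply/eqP; rewrite -subr_eq0; apply/eqP.
apply: (@roots_geq_poly_eq0 _ _ [seq n%:R | n <- iota 0 (size (q - r))]).
- apply/allP => _ /mapP[n _ ->].
  by rewrite rootE hornerD hornerN qr subrr.
- rewrite map_inj_uniq ?iota_uniq// => i j /eqP.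
  by rewrite eqr_nat => /eqP.
- by rewrite size_map size_iota.
Qed.

Definition gaussian_moments Y := forall p : nat,
  E (fun x => Y x ^+ p.+1) =
  p%:R * E (fun x => Y x ^+ 2) * E (fun x => Y x ^+ p.-1).

(** A polynomial identity that holds for all integers [n] holds for all complex
    [t], which extends the moment identity from real to complex combinations. *)
Lemma gaussian_moments_complex Y Z : good Y -> good Z ->
  (forall n : nat, gaussian_moments (fun x => Y x + n%:R * Z x)) ->
  forall t, gaussian_moments (fun x => Y x + t * Z x).
Proof.
move=> gY gZ h t p.
have poly m : exists q : {poly C}, forall t, E (fun x => (Y x + t * Z x) ^+ m) = q.[t].
  have [q [qE _ _]] := expect_power_poly m (good_cst ax 1) gY gZ.
  by exists q => u; rewrite -qE; apply: congr1; apply/funext => x; rewrite mul1r.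
have [q1 E1] := poly p.+1; have [q2 E2] := poly 2%N; have [q3 E3] := poly p.-1.
have q123 : q1 = p%:R *: (q2 * q3).
  apply: eq_poly_nat => n; rewrite -E1 h E2 E3 hornerZ hornerM.
  by rewrite mulrA.
by rewrite E1 E2 E3 q123 hornerZ hornerM mulrA.
Qed.

Section Isserlis.
Variable G : (T -> C) -> Prop.
Hypothesis G_good : forall Y, G Y -> good Y.
Hypothesis G_lin : forall t Y Z, G Y -> G Z -> G (fun x => Y x + t * Z x).
Hypothesis G_gauss : forall Y, G Y -> gaussian_moments Y.

(** The case where all variables but one coincide: the coefficient of degree 1 of
    the moment identity for [Y + t Z]. *)
Lemma isserlis_power Y Z p : G Y -> G Z -> E (fun x => Z x * Y x ^+ p) =
  p%:R * E (fun x => Z x * Y x) * E (fun x => Y x ^+ p.-1).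
Proof.
move=> GY GZ; have [n] := ubnP p; elim: n p => // n ih p le_p.
have gY := G_good GY; have gZ := G_good GZ.
have poly m : exists q : {poly C}, [/\
    forall t, E (fun x => (Y x + t * Z x) ^+ m) = q.[t],
    q`_0 = E (fun x => Y x ^+ m) &
    q`_1 = m%:R * E (fun x => Z x * Y x ^+ m.-1)].
  have [q [qE q0 q1]] := expect_power_poly m (good_cst ax 1) gY gZ.
  exists q; split=> [u||]; rewrite ?q0 ?q1 -?qE; last congr (_ * _);
    by apply: congr1; apply/funext => x; rewrite mul1r.
have [q1 [E1 _ q11]] := poly p.+1.
have [q2 [E2 q20 q21]] := poly 2%N.
have [q3 [E3 q30 q31]] := poly p.-1.
have q123 : q1 = p%:R *: (q2 * q3).
  apply: eq_poly_nat => m; rewrite -E1 hornerZ hornerM -E2 -E3.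
  by rewrite (G_gauss (G_lin _ GY GZ)) mulrA.
have := congr1 (fun q : {poly C} => q`_1) q123.
rewrite q11 coefZ coefM !big_ord_recl big_ord0 /= /bump /= addn0 q20 q21 q30 q31.
have p1 : p.+1%:R != 0 :> C by rewrite pnatr_eq0.
move=> h; apply: (mulfI p1); rewrite {}h addr0.
have -> : E (fun x => Z x * Y x ^+ 1) = E (fun x => Z x * Y x).
  by apply: congr1.
case: p le_p p1 {q1 E1 q11 q3 E3 q30 q31 q123} => [|[|p]] le_p _; rewrite ?mul0r ?mulr0//=.
  by ring.
rewrite ih; last by lia.
have := G_gauss GY p; case: p le_p => [|p] le_p /= h.
  by rewrite h; ring.
rewrite h -!natr1; ring.
Qed.

Variables (J : Type) (X : J -> T -> C).
Hypothesis GX : forall j, G (X j).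

Definition monomial (js : seq J) x := \prod_(j <- js) X j x.

Lemma monomial_cat u v x : monomial (u ++ v) x = monomial u x * monomial v x.
Proof. exact: big_cat. Qed.

Lemma monomial_cons j u x : monomial (j :: u) x = X j x * monomial u x.
Proof. exact: big_cons. Qed.

Lemma good_monomial js : good (monomial js).
Proof.
elim: js => [|j js ih].
  by rewrite /monomial; under eq_fun do rewrite big_nil; exact: (good_cst ax).
have -> : monomial (j :: js) = (fun x => X j x * monomial js x).
  by apply/funext => x; exact: monomial_cons.
by apply: (goodM ax) => //; exact: G_good.
Qed.

(** The image of a monomial under the derivation that maps [X j] to the
    covariance [E (Z X_j)]. *)
Definition dmonomial Z (js : seq J) x :=
  cuts (fun a j c => E (fun x => Z x * X j x) * monomial (a ++ c) x) js.

Lemma dmonomial_cons Z j js x : dmonomial Z (j :: js) x =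
  E (fun x => Z x * X j x) * monomial js x + X j x * dmonomial Z js x.
Proof.
rewrite /dmonomial /= -cutsM; congr (_ + _); apply: eq_cuts => a k c _.
by rewrite monomial_cons mulrCA.
Qed.

Lemma good_dmonomial Z js : good (dmonomial Z js).
Proof.
apply: (good_cuts (G := fun a j c x =>
  E (fun x => Z x * X j x) * monomial (a ++ c) x)) => a j c _.
exact/goodZ/good_monomial.
Qed.

(** The power [Y ^+ p] is a supply of factors that are turned one at a time into
    prescribed variables [X j], by comparing coefficients of degree 1 for
    [Y + t X_j]. *)
Lemma isserlis_polarized Y Z js p : G Y -> G Z ->
  E (fun x => Z x * monomial js x * Y x ^+ p) =
  E (fun x => dmonomial Z js x * Y x ^+ p) +
  p%:R * E (fun x => Z x * Y x) * E (fun x => monomial js x * Y x ^+ p.-1).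
Proof.
move=> + GZ; have gZ := G_good GZ.
elim: js Y p => [|j js ih] Y p GY.
  have mE x : monomial [::] x = 1 by exact: big_nil.
  have -> : (fun x => Z x * monomial [::] x * Y x ^+ p) = (fun x => Z x * Y x ^+ p).
    by apply/funext => x; rewrite mE mulr1.
  have -> : (fun x => monomial [::] x * Y x ^+ p.-1) = (fun x => Y x ^+ p.-1).
    by apply/funext => x; rewrite mE mul1r.
  have -> : (fun x => dmonomial Z [::] x * Y x ^+ p) = (fun=> 0).
    by apply/funext => x; rewrite mul0r.
  by rewrite (expect_cst ax) add0r isserlis_power.
have gY := G_good GY; have gj := G_good (GX j); have gm := good_monomial js.
have gd := good_dmonomial Z js.
have [q1 [E1 _ q11]] := expect_power_poly p.+1 (goodM ax gZ gm) gY gj.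
have [q2 [E2 q20 q21]] := expect_power_poly p gm gY gj.
have [q3 [E3 _ q31]] := expect_power_poly p.+1 gd gY gj.
pose a := E (fun x => Z x * Y x); pose b := E (fun x => Z x * X j x).
have aE t : E (fun x => Z x * (Y x + t * X j x)) = a + b * t.
  have -> : (fun x => Z x * (Y x + t * X j x)) =
      (fun x => Z x * Y x + t * (Z x * X j x)).
    by apply/funext => x; ring.
  rewrite (expectD ax) ?(expectM ax) 1?[t * _]mulrC//; last apply: goodZ;
  exact: (goodM ax).
have q123 : q1 = q3 + p.+1%:R *: ((a%:P + b *: 'X) * q2).
  apply: eq_poly_nat => n; rewrite -E1 ih; last exact: G_lin.
  rewrite !(hornerD, hornerZ, hornerM, hornerC, hornerX) -E2 -E3 aE.
  by rewrite mulrA.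
have := congr1 (fun q : {poly C} => q`_1) q123.
rewrite coefD coefZ mulrDl coefD coefCM -scalerAl coefZ coefXM /= q11 q31 q20 q21 /=.
rewrite [E (fun x => dmonomial Z (j :: js) x * _)](_ : _ =
   b * E (fun x => monomial js x * Y x ^+ p) +
   E (fun x => dmonomial Z js x * X j x * Y x ^+ p)); last first.
  rewrite -(expectM ax); last exact/(goodM ax gm)/goodX.
  rewrite -(expectD ax); last first.
  - exact/(goodM ax)/goodX/gY/(goodM ax).
  - exact/goodZ/(goodM ax gm)/goodX.
  by apply: congr1; apply/funext => x; rewrite dmonomial_cons -/b; ring.
have -> : (fun x => Z x * monomial js x * X j x * Y x ^+ p) =
    (fun x => Z x * monomial (j :: js) x * Y x ^+ p).
  by apply/funext => x; rewrite monomial_cons; ring.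
have -> : (fun x => monomial js x * X j x * Y x ^+ p.-1) =
    (fun x => monomial (j :: js) x * Y x ^+ p.-1).
  by apply/funext => x; rewrite monomial_cons; ring.
have p1 : p.+1%:R != 0 :> C by rewrite pnatr_eq0.
move=> h; apply: (mulfI p1); rewrite {}h -/a; ring.
Qed.

Lemma isserlis Z js : G Z ->
  E (fun x => Z x * monomial js x) = E (dmonomial Z js).
Proof.
move=> GZ; have := @isserlis_polarized Z Z js 0 GZ GZ.
rewrite !mul0r addr0; under eq_fun do rewrite expr0 mulr1.
by move=> ->; apply: congr1; apply/funext => x; rewrite expr0 mulr1.
Qed.

(** [derivation Z f f'] says that [f] is a polynomial in the variables [X j] and
    [f'] its image under the derivation that maps [X j] to [E (Z X_j)].  A
    relation is used because the function [f] does not determine the polynomial. *)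
Inductive derivation Z : (T -> C) -> (T -> C) -> Prop :=
| derivation_monomial js : derivation Z (monomial js) (dmonomial Z js)
| derivation_lin k f f' g g' : derivation Z f f' -> derivation Z g g' ->
    derivation Z (fun x => k * f x + g x) (fun x => k * f' x + g' x).

Lemma derivation_good Z f f' : derivation Z f f' -> good f /\ good f'.
Proof.
elim=> [js|k g g' h h' _ [gg gg'] _ [gh gh']].
  by split; [exact: good_monomial|exact: good_dmonomial].
by split; apply: (goodD ax) => //; exact: goodZ.
Qed.

(** Gaussian integration by parts: multiplication by [Z] is adjoint to the
    derivation along [Z]. *)
Lemma derivation_expect Z f f' : G Z -> derivation Z f f' ->
  E (fun x => Z x * f x) = E f'.
Proof.
move=> GZ; have gZ := G_good GZ.
elim=> [js|k g g' h h' dg ihg dh ihh]; first exact: isserlis.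
have [gg gg'] := derivation_good dg; have [gh gh'] := derivation_good dh.
rewrite (expectD ax) ?(expectM ax) -?ihg -?ihh//; last exact: goodZ.
rewrite -(expectM ax) -?(expectD ax); try exact/goodZ/(goodM ax);
  try exact: (goodM ax).
by apply: congr1; apply/funext => x; ring.
Qed.

Lemma derivation_cst Z k : derivation Z (fun=> k) (fun=> 0).
Proof.
have h := derivation_lin (k - 1) (derivation_monomial Z [::]) (derivation_monomial Z [::]).
have -> : (fun=> k) = (fun x => (k - 1) * monomial [::] x + monomial [::] x).
  by apply/funext => x; rewrite [monomial _ _]big_nil; ring.
have -> : (fun=> 0) = (fun x => (k - 1) * dmonomial Z [::] x + dmonomial Z [::] x).
  by apply/funext => x; rewrite /dmonomial /= mulr0 addr0.
exact: h.
Qed.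

Lemma derivationD Z f f' g g' : derivation Z f f' -> derivation Z g g' ->
  derivation Z (fun x => f x + g x) (fun x => f' x + g' x).
Proof.
move=> df dg; have := derivation_lin 1 df dg.
by under eq_fun do rewrite mul1r; under [X in derivation _ _ X]eq_fun do rewrite mul1r.
Qed.

Lemma derivationM Z f f' g g' : derivation Z f f' -> derivation Z g g' ->
  derivation Z (fun x => f x * g x) (fun x => f' x * g x + f x * g' x).
Proof.
move=> df dg; elim: df => [u|k f1 f1' f2 f2' _ ih1 _ ih2]; last first.
  have := derivation_lin k ih1 ih2.
  by congr (derivation _ _ _); apply/funext => x; ring.
elim: dg => [v|k g1 g1' g2 g2' _ ih1 _ ih2]; last first.
  have := derivation_lin k ih1 ih2.
  by congr (derivation _ _ _); apply/funext => x; ring.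
have := derivation_monomial Z (u ++ v).
congr (derivation _ _ _); apply/funext => x; first exact: monomial_cat.
rewrite /dmonomial cuts_cat [_ * monomial v x]mulrC -!cutsM.
by congr (_ + _); apply: eq_cuts => a j c _; rewrite ?catA !monomial_cat; ring.
Qed.

Lemma derivation_var Z j :
  derivation Z (X j) (fun=> E (fun x => Z x * X j x)).
Proof.
have := derivation_monomial Z [:: j].
congr (derivation _ _ _); apply/funext => x.
  exact: big_seq1.
by rewrite /dmonomial /= addr0 [monomial _ _]big_nil mulr1.
Qed.

Lemma derivation_sum Z I (r : seq I) (f f' : I -> T -> C) :
  (forall i, derivation Z (f i) (f' i)) ->
  derivation Z (fun x => \sum_(i <- r) f i x) (fun x => \sum_(i <- r) f' i x).
Proof.
move=> df; elim: r => [|i r ih].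
  have := derivation_cst Z 0.
  by congr (derivation _ _ _); apply/funext => x; rewrite big_nil.
have := derivationD (df i) ih.
by congr (derivation _ _ _); apply/funext => x; rewrite big_cons.
Qed.

End Isserlis.
End Expectation.

(** * Traces of words in a Gaussian matrix *)

Section LoopEquations.
Variables (C : numFieldType) (T H : Type) (n : nat).
Variables (E : (T -> C) -> C) (good : (T -> C) -> Prop).
Hypothesis ax : expectation_functional E good.
Variable G : (T -> C) -> Prop.
Hypothesis G_good : forall Y, G Y -> good Y.
Hypothesis G_lin : forall t Y Z, G Y -> G Z -> G (fun x => Y x + t * Z x).
Hypothesis G_gauss : forall Y, G Y -> gaussian_moments E Y.
Variables (X : H -> T -> 'M[C]_n) (b : H -> H -> C) (e : C).
Hypothesis GX : forall h i j, G (fun t => X h t i j).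
Hypothesis covX : forall f h i j k l,
  E (fun t => X f t i j * X h t k l) = ((i == l) && (j == k))%:R * (e * b f h).
Implicit Types (f h : H) (w v : seq H) (ws : seq (seq H)).

Definition wordmx w t : 'M[C]_n := \prod_(h <- w) X h t.

Lemma wordmx_cons h w t : wordmx (h :: w) t = X h t *m wordmx w t.
Proof. by rewrite /wordmx big_cons. Qed.

Lemma wordmx_cat v w t : wordmx (v ++ w) t = wordmx v t *m wordmx w t.
Proof. by rewrite /wordmx big_cat. Qed.

Lemma wordmx0 t : wordmx [::] t = 1%:M.
Proof. by rewrite /wordmx big_nil. Qed.

Let entry (u : 'I_n * 'I_n * H) (t : T) := X u.2 t u.1.1 u.1.2.
Let Gentry u : G (entry u). Proof. exact: GX. Qed.
Notation der Z := (derivation E entry Z).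

Let good_entry h i j : good (fun t => X h t i j).
Proof. by apply: G_good; exact: GX. Qed.

Lemma good_wordmx w i j : good (fun t => wordmx w t i j).
Proof.
elim: w i j => [|h w ih] i j.
  by under eq_fun do rewrite wordmx0; exact: (good_cst ax).
under eq_fun do rewrite wordmx_cons mxE.
by apply: (good_sum ax) => k; apply: (goodM ax).
Qed.

Lemma good_tr w : good (fun t => \tr (wordmx w t)).
Proof. by apply: (good_sum ax) => i; exact: good_wordmx. Qed.

Definition centered w t := \tr (wordmx w t) - E (fun t => \tr (wordmx w t)).

Definition centered_prod ws t := \prod_(w <- ws) centered w t.

Lemma good_centered w : good (centered w).
Proof. exact: (goodD ax (good_tr w) (good_cst ax _)). Qed.

Lemma centered_prod_cons w ws t :
  centered_prod (w :: ws) t = centered w t * centered_prod ws t.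
Proof. exact: big_cons. Qed.

Lemma good_centered_prod ws : good (centered_prod ws).
Proof.
elim: ws => [|w ws ih].
  by rewrite /centered_prod; under eq_fun do rewrite big_nil; exact: (good_cst ax).
have -> : centered_prod (w :: ws) = (fun t => centered w t * centered_prod ws t).
  by apply/funext => t; exact: centered_prod_cons.
by apply: (goodM ax) => //; exact: good_centered.
Qed.

Section Derivative.
Variables (f : H) (i j : 'I_n).
Let Z t := X f t i j.

(** The derivation along the entry [(i, j)] replaces a factor [X h] by
    [e <f, h>] times the elementary matrix with entry 1 at [(j, i)]. *)
Lemma derivation_wordmx w k l : der Z (fun t => wordmx w t k l)
  (fun t => cuts (fun a h c =>
     e * b f h * (wordmx a t k j * wordmx c t i l)) w).
Proof.
elim: w k l => [|h w ih] k l.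
  by under eq_fun do rewrite wordmx0; exact: derivation_cst.
under eq_fun do rewrite wordmx_cons mxE.
have := derivation_sum (index_enum 'I_n) (fun r =>
  derivationM (derivation_var E entry Z (k, r, h)) (ih r l)).
congr (derivation _ _ _ _ _); apply/funext => t.
rewrite big_split /=; congr (_ + _).
  rewrite (bigD1 i) //= big1 => [|r /negbTE ri]; last first.
    by rewrite /Z /entry /= covX eq_sym ri /= mul0r mul0r.
  by rewrite /Z /entry /= covX eqxx /= addr0 wordmx0 mxE [j == k]eq_sym; ring.
transitivity (\sum_r cuts (fun a x c => X h t k r * (e * b f x *
    (wordmx a t r j * wordmx c t i l))) w).
  by apply: eq_bigr => r _; rewrite cutsM.
rewrite sum_cuts; apply: eq_cuts => a x c _.
rewrite wordmx_cons mxE mulr_suml mulr_sumr; apply: eq_bigr => r _.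
by ring.
Qed.

(** By cyclicity of the trace, removing a letter from [Tr X_v], [v = a h c],
    leaves an entry of [X_(c a)]. *)
Lemma derivation_centered v : der Z (centered v)
  (fun t => cuts (fun a h c => e * b f h * wordmx (c ++ a) t i j) v).
Proof.
have := derivationD (derivation_sum (index_enum 'I_n)
    (fun k => derivation_wordmx v k k))
  (derivation_cst E entry Z (- E (fun t => \tr (wordmx v t)))).
congr (derivation _ _ _ _ _); apply/funext => t.
rewrite addr0 sum_cuts; apply: eq_cuts => a h c _.
rewrite -mulr_sumr; congr (_ * _); rewrite wordmx_cat mxE.
by apply: eq_bigr => k _; rewrite mulrC.
Qed.

Lemma derivation_centered_prod ws : der Z (centered_prod ws)
  (fun t => selections (fun v vs => cuts (fun a h c =>
     e * b f h * wordmx (c ++ a) t i j) v * centered_prod vs t) ws).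
Proof.
elim: ws => [|w ws ih].
  have := derivation_cst E entry Z 1.
  by congr (derivation _ _ _ _ _); apply/funext => t; rewrite [RHS]big_nil.
have := derivationM (derivation_centered w) ih.
congr (derivation _ _ _ _ _); apply/funext => t.
  by rewrite centered_prod_cons.
rewrite /selections /= -cutsM; congr (_ + _); apply: eq_cuts => vs v vs' _.
by rewrite centered_prod_cons mulrCA.
Qed.

End Derivative.

(** Summing the integration by parts over all entries [(i, j)] of the first
    matrix of the trace: a contraction within the trace splits it in two, and a
    contraction with another trace merges both. *)
Lemma expect_tr_centered f w ws :
  E (fun t => \tr (wordmx (f :: w) t) * centered_prod ws t) =
  E (fun t => cuts (fun a h c =>
       e * b f h * (\tr (wordmx a t) * \tr (wordmx c t))) w * centered_prod ws t +
     selections (fun v vs => cuts (fun a h c =>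
       e * b f h * \tr (wordmx (c ++ a ++ w) t)) v * centered_prod vs t) ws).
Proof.
have gQ := good_centered_prod ws.
transitivity (E (fun t => \sum_i \sum_j
    X f t i j * (wordmx w t j i * centered_prod ws t))).
  apply: congr1; apply/funext => t; rewrite mulr_suml.
  apply: eq_bigr => i _; rewrite wordmx_cons mxE mulr_suml.
  by apply: eq_bigr => j _; rewrite mulrA.
have gXQ i j : good (fun t => X f t i j * (wordmx w t j i * centered_prod ws t)).
  by apply: (goodM ax) => //; apply: (goodM ax) => //; exact: good_wordmx.
rewrite (expect_sum ax) => [|i]; last exact: (good_sum ax).
have dXQ i j := derivationM (derivation_wordmx f i j w j i)
                            (derivation_centered_prod f i j ws).
have gd i j := (derivation_good ax G_good Gentry (dXQ i j)).2.
under eq_bigr => i _.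
  rewrite (expect_sum ax) //.
  under eq_bigr => j _ do
    rewrite (derivation_expect ax G_good G_lin G_gauss Gentry (GX f i j) (dXQ i j)).
  rewrite -(expect_sum ax) //.
over.
rewrite -(expect_sum ax) => [|i]; last exact: (good_sum ax).
apply: congr1; apply/funext => t.
under eq_bigr => i _ do rewrite big_split /= -mulr_suml sum_cuts.
rewrite big_split /= -mulr_suml sum_cuts; congr (_ * _ + _).
  apply: eq_cuts => a h c _; rewrite /mxtrace mulr_sumr mulr_sumr.
  apply: eq_bigr => i _; rewrite -mulr_sumr; congr (_ * _).
  by rewrite mulr_suml.
rewrite /selections.
under eq_bigr => i _ do (under eq_bigr => j _ do rewrite -cutsM; rewrite sum_cuts).
rewrite sum_cuts; apply: eq_cuts => vs v vs' _.
rewrite -cutsMr.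
transitivity (\sum_i \sum_j cuts (fun a h c => e * b f h *
   (wordmx (c ++ a) t i j * wordmx w t j i) * centered_prod (vs ++ vs') t) v).
  apply: eq_bigr => i _; apply: eq_bigr => j _; rewrite -cutsMr -cutsM.
  by apply: eq_cuts => a h c _; ring.
under eq_bigr => i _ do rewrite sum_cuts.
rewrite sum_cuts; apply: eq_cuts => a h c _.
rewrite catA (wordmx_cat (c ++ a)) /mxtrace mulr_sumr mulr_suml; apply: eq_bigr => i _.
by rewrite mxE mulr_sumr mulr_suml.
Qed.

Let mean w := E (fun t => \tr (wordmx w t)).
Let cum ws := E (centered_prod ws).

Let trE w t : \tr (wordmx w t) = centered w t + mean w.
Proof. by rewrite /centered -/(mean w) subrK. Qed.

Let cum0 : cum [::] = 1.
Proof.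
rewrite -(expect_cst ax 1) /cum; apply: congr1; apply/funext => t.
exact: big_nil.
Qed.

Let cum1 w : cum [:: w] = 0.
Proof.
rewrite -(subrr (mean w)) -[X in _ - X](expect_cst ax).
rewrite -[X in _ = _ + X]mulN1r -(expectM ax); last exact: (good_cst ax).
rewrite -(expectD ax (good_tr w) (goodZ ax _ (good_cst ax _))) /cum.
apply: congr1; apply/funext => t.
by rewrite [LHS]big_seq1 mulN1r.
Qed.

Let expect_tr_prod w ws :
  E (fun t => \tr (wordmx w t) * centered_prod ws t) =
  cum (w :: ws) + mean w * cum ws.
Proof.
have gQ u := good_centered_prod u.
rewrite -(expectM ax)// -(expectD ax)//; last exact: (goodZ ax).
by apply: congr1; apply/funext => t; rewrite trE mulrDl centered_prod_cons.
Qed.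

Let expect_tr_tr_prod v w ws :
  E (fun t => \tr (wordmx v t) * \tr (wordmx w t) * centered_prod ws t) =
  cum [:: v, w & ws] + mean v * cum (w :: ws) + mean w * cum (v :: ws) +
  mean v * mean w * cum ws.
Proof.
have gQ u := good_centered_prod u.
have gcQ u us : good (fun t => centered u t * centered_prod us t).
  exact/(goodM ax (good_centered u)).
transitivity (E (fun t => \tr (wordmx v t) * centered_prod (w :: ws) t +
    mean w * (\tr (wordmx v t) * centered_prod ws t))).
  apply: congr1; apply/funext => t; rewrite centered_prod_cons.
  by rewrite (trE w) ; ring.
rewrite (expectD ax) ?(expectM ax) ?expect_tr_prod; first by ring.
- exact/(goodM ax)/gQ/good_tr.
- exact/(goodM ax)/gQ/good_tr.
- exact/(goodZ ax)/(goodM ax)/gQ/good_tr.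
Qed.

Let mean_cons f w : mean (f :: w) = cuts (fun a h c =>
  e * b f h * (cum [:: a; c] + mean a * mean c)) w.
Proof.
have := expect_tr_centered f w [::].
rewrite expect_tr_prod cum0 cum1 add0r mulr1 => ->.
transitivity (E (fun t => cuts (fun a h c =>
    e * b f h * (\tr (wordmx a t) * \tr (wordmx c t))) w)).
  apply: congr1; apply/funext => t.
  by rewrite /selections /= addr0 [centered_prod _ _]big_nil mulr1.
rewrite (expect_cuts ax (G := fun a h c t => e * b f h *
  (\tr (wordmx a t) * \tr (wordmx c t)))) => [|a h c _]; last first.
  exact/(goodZ ax)/(goodM ax)/good_tr/good_tr.
apply: eq_cuts => a h c _; rewrite (expectM ax); last exact/(goodM ax)/good_tr/good_tr.
have := expect_tr_tr_prod a c [::]; rewrite !cum1 !mulr0 !addr0 cum0 mulr1 => <-.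
congr (_ * _); apply: congr1; apply/funext => t.
by rewrite [centered_prod _ _]big_nil mulr1.
Qed.

(** The equations follow from [expect_tr_centered] after every trace has been
    decomposed as the sum of its mean and of the centered trace. *)
Lemma gaussian_loop_equations : e * n%:R = 1 ->
  loop_equations b e (fun w => e * mean w) cum.
Proof.
have gQ u := good_centered_prod u.
move=> en; split=> [|f w||ws|f w ws].
- rewrite -en -(expect_cst ax n%:R) /mean; congr (_ * _).
  by apply: congr1; apply/funext => t; rewrite wordmx0 mxtrace1.
- by rewrite mean_cons -cutsM; apply: eq_cuts => a h c _; ring.
- exact: cum0.
- rewrite -(expect_cst ax 0) /cum; apply: congr1; apply/funext => t.
  rewrite centered_prod_cons /centered; under eq_fun do rewrite wordmx0 mxtrace1.
  by rewrite wordmx0 mxtrace1 (expect_cst ax) subrr mul0r.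
- have := expect_tr_prod (f :: w) ws; rewrite expect_tr_centered.
  have gS v vs : good (fun t => cuts (fun a h c =>
      e * b f h * \tr (wordmx (c ++ a ++ w) t)) v * centered_prod vs t).
    apply: (goodM ax) => //.
    apply: (good_cuts ax (G := fun a h c t =>
      e * b f h * \tr (wordmx (c ++ a ++ w) t))) => a h c _.
    exact/(goodZ ax)/good_tr.
  have gW : good (fun t => cuts (fun a h c =>
      e * b f h * (\tr (wordmx a t) * \tr (wordmx c t))) w * centered_prod ws t).
    apply: (goodM ax) => //.
    apply: (good_cuts ax (G := fun a h c t => e * b f h *
      (\tr (wordmx a t) * \tr (wordmx c t)))) => a h c _.
    exact/(goodZ ax)/(goodM ax)/good_tr/good_tr.
  rewrite (expectD ax) //; last first.
    exact: (good_cuts ax (G := fun vs v vs' t => cuts (fun a h c =>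
      e * b f h * \tr (wordmx (c ++ a ++ w) t)) v * centered_prod (vs ++ vs') t)).
  move=> E1; rewrite -(addrK (mean (f :: w) * cum ws) (cum ((f :: w) :: ws))) -{}E1.
  rewrite mean_cons addrAC; congr (_ + _).
    under eq_fun do rewrite -cutsMr.
    rewrite (expect_cuts ax (G := fun a h c t => e * b f h *
       (\tr (wordmx a t) * \tr (wordmx c t)) * centered_prod ws t)); last first.
      move=> a h c _; apply: (goodM ax) => //.
      exact/(goodZ ax)/(goodM ax)/good_tr/good_tr.
    rewrite -mulrN -cutsMr -cutsD.
    apply: eq_cuts => a h c _; under eq_fun do rewrite -mulrA.
    rewrite (expectM ax) ?expect_tr_tr_prod; first by ring.
    by apply: (goodM ax) => //; exact/(goodM ax)/good_tr/good_tr.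
  rewrite /selections (expect_cuts ax (G := fun vs v vs' t => cuts (fun a h c =>
      e * b f h * \tr (wordmx (c ++ a ++ w) t)) v * centered_prod (vs ++ vs') t)) //.
  apply: eq_cuts => vs v vs' _; under eq_fun do rewrite -cutsMr.
  rewrite (expect_cuts ax (G := fun a h c t => e * b f h *
     \tr (wordmx (c ++ a ++ w) t) * centered_prod (vs ++ vs') t)); last first.
    by move=> a h c _; apply: (goodM ax) => //; exact/(goodZ ax)/good_tr.
  apply: eq_cuts => a h c _; under eq_fun do rewrite -mulrA.
  rewrite (expectM ax) ?expect_tr_prod; first by ring.
  exact/(goodM ax)/gQ/good_tr.
Qed.

End LoopEquations.

(** * Moments of the normal law *)

Section NormalMoments.
Variable R : realType.
Notation mu := (@lebesgue_measure R).
Implicit Types (s x : R) (k : nat).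

Lemma expR_ge_power k x : 0 <= x -> x ^+ k <= k`!%:R * expR x.
Proof.
case: k => [|k] x0; first by rewrite expr0 fact0 mul1r -expR0 ler_expR.
rewrite -ler_pdivrMl ?ltr0n ?fact_gt0// mulrC.
by apply: le_trans (expR_ge1Dxn k x0); rewrite lerDr.
Qed.

(** With [y = x ^+ 2 / (4 s ^+ 2)] the left hand function is [y ^+ k] times
    [expR (- 2 y)], up to the constant, and half of the exponent absorbs the
    power; the wider Gaussian on the right hand side remains. *)
Lemma even_power_normal_fun s k x : s != 0 ->
  x ^+ (k.*2) * normal_fun 0 s x <=
  (s ^+ 2 *+ 4) ^+ k * k`!%:R * normal_fun 0 (Num.sqrt 2 * s) x.
Proof.
move=> s0; have s2 : 0 < s ^+ 2 by rewrite exprn_even_gt0.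
pose y := x ^+ 2 / (s ^+ 2 *+ 4).
have y0 : 0 <= y by rewrite divr_ge0 ?sqr_ge0// mulrn_wge0// ltW.
have -> : x ^+ k.*2 = (s ^+ 2 *+ 4) ^+ k * y ^+ k.
  rewrite -exprMn -mul2n exprM /y; congr (_ ^+ _).
  by field.
have -> : normal_fun 0 s x = expR (- y) * expR (- y).
  by rewrite -expRD /normal_fun /y; congr expR; field.
have -> : normal_fun 0 (Num.sqrt 2 * s) x = expR (- y).
  rewrite /normal_fun /y exprMn sqr_sqrtr//; congr expR; field.
  by rewrite s0.
rewrite -!mulrA ler_pM2l ?exprn_gt0 ?mulrn_wgt0// mulrA.
rewrite ler_pM2r ?expR_gt0// -(ler_pM2r (expR_gt0 y)).
by rewrite -mulrA -expRD addNr expR0 mulr1 expR_ge_power.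
Qed.

Lemma power_normal_pdf_bound s k : s != 0 -> exists M : R, forall x,
  `|x| ^+ k * normal_pdf 0 s x <= M * normal_pdf 0 (Num.sqrt 2 * s) x.
Proof.
move=> s0; have s'0 : Num.sqrt 2 * s != 0 by rewrite mulf_neq0// gt_eqF ?sqrtr_gt0.
(* [`|x| ^+ k] is at most [1 + x ^+ (2 * k)], which leaves only even powers. *)
pose M j : R := (s ^+ 2 *+ 4) ^+ j * j`!%:R.
exists ((M 0%N + M k) * (normal_peak s / normal_peak (Num.sqrt 2 * s))) => x.
have p0 := normal_peak_gt0 s0; have p'0 := normal_peak_gt0 s'0.
rewrite !normal_pdfE// mulrCA -[leRHS]mulrA.
have -> : (normal_peak s / normal_peak (Num.sqrt 2 * s) *
    (normal_peak (Num.sqrt 2 * s) * normal_fun 0 (Num.sqrt 2 * s) x)) =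
    normal_peak s * normal_fun 0 (Num.sqrt 2 * s) x.
  by field; rewrite gt_eqF.
rewrite [leRHS]mulrCA ler_pM2l// mulrDl.
apply: le_trans (lerD (even_power_normal_fun 0 x s0) (even_power_normal_fun k x s0)).
rewrite -mulrDl ler_wpM2r ?normal_fun_ge0// double0 expr0.
rewrite -mul2n exprM -real_normK ?num_real// -exprM mulnC exprM.
have [h|/ltW h] := lerP (`|x| ^+ k) 1; first by rewrite (le_trans h)// lerDl sqr_ge0.
by rewrite (@le_trans _ _ ((`|x| ^+ k) ^+ 2)) ?lerDr// expr2 ler_peMr// exprn_ge0.
Qed.

Lemma integrable_power_normal_pdf s k : s != 0 ->
  mu.-integrable setT (fun x => (x ^+ k * normal_pdf 0 s x)%:E).
Proof.
move=> s0; have [M hM] := power_normal_pdf_bound k s0.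
apply: (le_integrable measurableT _ _
  (integrableZl measurableT M (integrable_normal_pdf 0 (Num.sqrt 2 * s)))).
  by apply/measurable_EFinP/measurable_funM => //; exact: measurable_normal_pdf.
move=> x _ /=; rewrite lee_fin normrM normrX (ger0_norm (normal_pdf_ge0 _ _ _)).
by apply: le_trans (hM x) _; exact: ler_norm.
Qed.

Lemma is_derive_power_normal_pdf s k x : s != 0 ->
  is_derive x 1 (fun x => - s ^+ 2 * (x ^+ k * normal_pdf 0 s x))
    (x ^+ k.+1 * normal_pdf 0 s x - s ^+ 2 * k%:R * (x ^+ k.-1 * normal_pdf 0 s x)).
Proof.
move=> s0; rewrite !normal_pdfE//.
pose q := (s ^+ 2 *+ 2)^-1; pose p := normal_peak s.
have pdfE y : normal_peak s * normal_fun 0 s y = p * expR (- q * y ^+ 2).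
  by rewrite /normal_fun subr0 !mulNr [y ^+ 2 * _]mulrC.
have dX n : is_derive x 1 (fun y : R => y ^+ n) (n%:R * x ^+ n.-1).
  have := is_deriveX n (is_derive_id x 1); rewrite exprfctE => h.
  by apply: is_derive_eq h _; rewrite [_ *: 1]mulr1.
have dq := is_deriveZ (- q) (dX 2%N).
have de := @is_derive1_comp R expR _ x _ _ (is_derive_expR _) dq.
have := is_deriveZ (- s ^+ 2 * p) (is_deriveM (dX k) de).
set F := (X in is_derive _ _ X); set G := (X in _ -> is_derive _ _ X _).
have -> : F = G.
  apply/funext => y; rewrite /G pdfE.
  change (- s ^+ 2 * p * (y ^+ k * expR (- q * y ^+ 2)) =
          - s ^+ 2 * (y ^+ k * (p * expR (- q * y ^+ 2)))).
  by rewrite -!mulrA [p * (_ * _)]mulrCA.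
pose E := expR (- q * x ^+ 2).
have <- : - s ^+ 2 * p * (x ^+ k * (E * (- q * (2 * x ^+ 1))) +
                          E * (k%:R * x ^+ k.-1)) =
    x ^+ k.+1 * (normal_peak s * normal_fun 0 s x) -
    s ^+ 2 * k%:R * (x ^+ k.-1 * (normal_peak s * normal_fun 0 s x)).
  rewrite pdfE -/E expr1 (exprS x).
  move: (x ^+ k) (x ^+ k.-1) (E) (p) => X X' E' p'.
  by rewrite /q; field.
by move=> h; exact: h.
Qed.

Lemma continuous_power_normal_pdf s k : s != 0 ->
  continuous (fun x => x ^+ k * normal_pdf 0 s x).
Proof.
move=> s0 x; apply: cvgM; first exact: exprn_continuous.
exact: continuous_normal_pdf.
Qed.

(** Integration by parts: the right hand side minus the left hand side is the
    integral of the derivative of [s ^+ 2 * x ^+ k * normal_pdf 0 s x], which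
    vanishes at infinity. *)
Lemma integral_power_normal_pdf s k : s != 0 ->
  \int[mu]_x (x ^+ k.+1 * normal_pdf 0 s x) =
  s ^+ 2 * k%:R * \int[mu]_x (x ^+ k.-1 * normal_pdf 0 s x).
Proof.
move=> s0.
pose F x := - s ^+ 2 * (x ^+ k * normal_pdf 0 s x).
pose g x := x ^+ k.+1 * normal_pdf 0 s x - s ^+ 2 * k%:R * (x ^+ k.-1 * normal_pdf 0 s x).
have ig1 := integrable_power_normal_pdf k.+1 s0.
have ig2 := integrableZl measurableT (s ^+ 2 * k%:R) (integrable_power_normal_pdf k.-1 s0).
have ig : mu.-integrable setT (EFin \o g).
  by have := integrableB measurableT ig1 ig2.
have cg : continuous g.
  move=> x; apply: cvgB; first exact: continuous_power_normal_pdf.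
  by apply: cvgM; [exact: cvg_cst|exact: continuous_power_normal_pdf].
have dF (x : R) := is_derive_power_normal_pdf k x s0.
have cF : continuous F.
  by move=> x; apply: cvgM; [exact: cvg_cst|exact: continuous_power_normal_pdf].
pose A n : set R := `[- n.+1%:R, n.+1%:R]%classic.
have FTC n : (\int[mu]_(x in A n) (g x)%:E = (F n.+1%:R - F (- n.+1%:R))%:E)%E.
  rewrite EFinB; apply: continuous_FTC2.
  - by have := ltr0Sn R n; lra.
  - by apply: continuous_subspaceT.
  - split=> [x _||]; last 2 first.
    + exact/cvg_at_right_filter/cF.
    + exact/cvg_at_left_filter/cF.
    by have [] := dF x.
  - by move=> x _; rewrite derive1E; apply: derive_val.
(* A spare factor [x] makes the boundary terms [O (1 / n)]. *)
have lim0 : F n.+1%:R - F (- n.+1%:R) @[n --> \oo] --> (0 : R).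
  have [M hM] := power_normal_pdf_bound k.+1 s0.
  have s'0 : Num.sqrt 2 * s != 0 by rewrite mulf_neq0// gt_eqF ?sqrtr_gt0.
  pose B := `|M| * normal_peak (Num.sqrt 2 * s).
  have hB x : x != 0 -> `|F x| <= s ^+ 2 * (B / `|x|).
    move=> x0; rewrite /F normrM normrN (ger0_norm (sqr_ge0 s)) ler_wpM2l ?sqr_ge0//.
    rewrite ler_pdivlMr ?normr_gt0// normrM normrX.
    rewrite (ger0_norm (normal_pdf_ge0 _ _ _)) mulrAC -exprSr.
    apply: le_trans (hM x) _; apply: (@le_trans _ _ (`|M| * normal_pdf 0 (Num.sqrt 2 * s) x)).
      by rewrite ler_wpM2r ?normal_pdf_ge0// ler_norm.
    by rewrite ler_wpM2l// normal_pdf_ub.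
  rewrite -(subrr 0).
  have F0 (e : R) : `|e| = 1 -> F (e * n.+1%:R) @[n --> \oo] --> (0 : R).
    move=> e1; apply/norm_cvg0P.
    apply: (@squeeze_cvgr _ _ _ _ (fun=> 0) (fun n => s ^+ 2 * (B * harmonic n))).
    - apply: nearW => n; rewrite normr_ge0/=; apply: le_trans (hB _ _) _.
        by rewrite -normr_gt0 normrM e1 mul1r normr_gt0.
      by rewrite normrM e1 mul1r normr_nat.
    - exact: cvg_cst.
    - rewrite -[0](mulr0 (s ^+ 2)) -[X in _ * X](mulr0 B).
      by do 2 apply: cvgMl_tmp; exact: cvg_harmonic.
  apply: cvgB; first by have := F0 1 (normr1 _); under eq_fun do rewrite mul1r.
  by have := F0 (-1) (normrN1 _); under eq_fun do rewrite mulN1r.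
have limg : (\int[mu]_(x in A n) (g x)%:E)%E @[n --> \oo] -->
    (\int[mu]_x (g x)%:E)%E.
  under eq_fun do rewrite integral_mkcond.
  apply: (@dominated_cvg _ _ R mu setT measurableT
    (fun n => (EFin \o g) \_ (A n)) (EFin \o g) (fun x => `|g x|%:E)) => //.
  - move=> n; apply/(measurable_restrictT _ _).1 => //.
      exact: measurable_itv.
    exact: measurable_funTS (measurable_int _ ig).
  - move=> x _; apply: cvg_near_cst; near=> n; rewrite patchE mem_set//=.
    rewrite /A /= in_itv/= -ler_norml.
    apply: (@le_trans _ _ n%:R); last by rewrite ler_nat.
    by near: n; exact: nbhs_infty_ger.
  - by have := integrable_abse ig.
  - move=> n x _; rewrite patchE; case: ifP => _ //=.
    by rewrite normr0 lee_fin.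
have intg0 : (\int[mu]_x (g x)%:E)%E = 0%E.
  rewrite -(cvg_lim _ limg)//; apply/cvg_lim => //.
  under eq_fun do rewrite FTC.
  by apply: cvg_EFin; [exact: nearW|exact: lim0].
have : \int[mu]_x g x = 0 by rewrite /Rintegral intg0.
rewrite (RintegralB measurableT ig1 ig2).
rewrite RintegralZl//; last exact: integrable_power_normal_pdf.
by move=> /eqP; rewrite subr_eq0 => /eqP.
Unshelve. all: by end_near. Qed.

End NormalMoments.

Section NormalProb.
Variables (R : realType) (s : R).
Hypothesis s0 : s != 0.
Notation mu := (@lebesgue_measure R).
Notation nu := (normal_prob 0 s).

(** The density serves as Radon-Nikodym derivative, which makes the change of
    variables formula available for the normal law. *)
Lemma ae_eq_RN_normal : ae_eq mu setT (Radon_Nikodym_SigmaFinite.f nu mu)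
  (EFin \o normal_pdf 0 s).
Proof.
have dom := @normal_prob_dominates R 0 s.
apply: integral_ae_eq => //.
- exact: Radon_Nikodym_SigmaFinite.f_integrable.
- by apply/measurable_EFinP; exact: measurable_normal_pdf.
- by move=> E _ mE; rewrite -Radon_Nikodym_SigmaFinite.f_integral.
Qed.

Lemma ge0_integral_normal_prob (h : R -> R) : measurable_fun setT h ->
  (forall x, 0 <= h x) ->
  (\int[nu]_x (h x)%:E = \int[mu]_x (h x * normal_pdf 0 s x)%:E)%E.
Proof.
move=> mh h0; have dom := @normal_prob_dominates R 0 s.
rewrite -(Radon_Nikodym_SigmaFinite.change_of_variables dom)//; last exact/measurable_EFinP.
apply: ae_eq_integral => //.
- apply: emeasurable_funM; first exact/measurable_EFinP.
  exact: measurable_int (Radon_Nikodym_SigmaFinite.f_integrable dom).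
- apply/measurable_EFinP/measurable_funM => //; exact: measurable_normal_pdf.
- by apply: filterS ae_eq_RN_normal => x /= h1 _; rewrite EFinM h1.
Qed.

Lemma integrable_power_normal_prob k :
  nu.-integrable setT (fun x => (x ^+ k)%:E).
Proof.
have mX : measurable_fun setT (fun x : R => x ^+ k) by [].
apply/integrableP; split; first exact/measurable_EFinP.
rewrite (ge0_integral_normal_prob (h := fun x => `|x ^+ k|)) //; last first.
  exact: measurableT_comp.
have /integrableP[_] := integrable_power_normal_pdf k s0.
apply: le_lt_trans; rewrite le_eqVlt; apply/orP; left; apply/eqP.
apply: eq_integral => x _ /=.
by rewrite normrM (ger0_norm (normal_pdf_ge0 _ _ _)).
Qed.

Lemma integral_power_normal_prob k :
  \int[nu]_x (x ^+ k) = \int[mu]_x (x ^+ k * normal_pdf 0 s x).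
Proof.
have dom := @normal_prob_dominates R 0 s.
rewrite /Rintegral; congr fine.
rewrite -(Radon_Nikodym_change_of_variables dom)//; last first.
  exact: integrable_power_normal_prob.
have mX : measurable_fun setT (fun x : R => x ^+ k) by [].
apply: ae_eq_integral => //.
- apply: emeasurable_funM; first exact/measurable_EFinP.
  apply: measurable_int (Radon_Nikodym_integrable _ ); exact: dom.
- apply/measurable_EFinP/measurable_funM => //; exact: measurable_normal_pdf.
- have h := ae_eq_trans
    (ae_eq_sym (ae_eq_Radon_Nikodym_SigmaFinite dom measurableT)) ae_eq_RN_normal.
  by apply: filterS h => x /= h1 _; rewrite EFinM h1.
Qed.

End NormalProb.

Section GaussianVariable.
Variables (R : realType) (d : measure_display) (T : measurableType d).
Variables (P : probability T R) (Y : T -> R).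
Hypothesis gY : centered_gaussian P Y.

(** [v] is the variance; the degenerate law, with [v = 0], needs no density. *)
Lemma centered_gaussian_moments : exists v : R, forall k,
  P.-integrable setT (fun t => (Y t ^+ k)%:E) /\
  \int[P]_t (Y t ^+ k.+1) = v * k%:R * \int[P]_t (Y t ^+ k.-1).
Proof.
have [mY [s s_ge0 law]] := gY; exists (s ^+ 2) => k.
have mX n : measurable_fun setT (fun x : R => x ^+ n) by [].
have [nu [nuE [inu mnu]]] : exists nu : {measure set (measurableTypeR R) -> \bar R},
    (forall A, measurable A -> P (Y @^-1` A) = nu A) /\
    (forall n, nu.-integrable setT (fun x => (x ^+ n)%:E)) /\
    \int[nu]_x (x ^+ k.+1) = s ^+ 2 * k%:R * \int[nu]_x (x ^+ k.-1).
  have [s0|s0] := eqVneq s 0.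
    exists (dirac (0 : measurableTypeR R)); split; first by move=> A /law ->; rewrite s0 eqxx.
    split=> [n|].
      apply/integrableP; split; first exact/measurable_EFinP.
      rewrite integral_dirac ?diracT ?mul1e//= ?ltry//.
      by apply/measurable_EFinP; exact: measurableT_comp.
    rewrite /Rintegral integral_dirac ?diracT ?mul1e//=; last exact/measurable_EFinP.
    by rewrite s0 !expr0n /= !mul0r.
  exists (normal_prob 0 s); split; first by move=> A /law ->; rewrite (negbTE s0).
  split=> [n|]; first exact: integrable_power_normal_prob.
  by rewrite !integral_power_normal_prob// integral_power_normal_pdf.
pose Y' : {RV P >-> measurableTypeR R} :=
  HB.pack Y (@isMeasurableFun.Build _ _ T (measurableTypeR R) Y mY).
have transfer (h : measurableTypeR R -> \bar R) :
    (\int[distribution P Y']_x h x = \int[nu]_x h x)%E.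
  by apply: eq_measure_integral => A mA _; exact: nuE.
have iP n : P.-integrable setT (fun t => (Y t ^+ n)%:E).
  apply/integrableP; split; first by apply/measurable_EFinP; exact: measurable_funX.
  have /integrableP[mXn] := inu n; rewrite -transfer.
  rewrite ge0_integral_distribution//.
  exact: measurableT_comp.
have iE n : \int[P]_t (Y t ^+ n) = \int[nu]_x (x ^+ n).
  rewrite /Rintegral; congr fine.
  rewrite -transfer integral_distribution//.
    by have /integrableP[] := inu n.
  exact: iP.
split; first exact: iP.
by rewrite !iE.
Qed.

End GaussianVariable.

(** * Random variables with moments of all orders *)

Section AllMoments.
Variables (R : realType) (d : measure_display) (T : measurableType d).
Variable P : probability T R.
Implicit Types (Y Z : T -> R) (f g : T -> R[i]).

Definition all_moments Y := measurable_fun setT Y /\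
  forall k, P.-integrable setT (fun t => (`|Y t| ^+ k)%:E).

Lemma all_moments_integrable Y : all_moments Y ->
  P.-integrable setT (EFin \o Y).
Proof.
move=> [mY /(_ 1%N) iY]; apply: le_integrable iY => //.
  exact/measurable_EFinP.
by move=> t _ /=; rewrite lee_fin expr1 normr_id.
Qed.

Lemma all_moments_cst r : all_moments (fun=> r).
Proof.
split=> [|k]; first exact: measurable_cst.
exact: finite_measure_integrable_cst.
Qed.

Lemma all_momentsM Y Z : all_moments Y -> all_moments Z ->
  all_moments (fun t => Y t * Z t).
Proof.
move=> [mY iY] [mZ iZ]; have mYZ := measurable_funM mY mZ; split=> // k.
apply: le_integrable (integrableD measurableT (iY (k * 2)%N) (iZ (k * 2)%N)) => //.
  by apply/measurable_EFinP/measurable_funX; exact: measurableT_comp.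
move=> t _; rewrite /= lee_fin ger0_norm ?exprn_ge0// [leRHS]ger0_norm; last first.
  by rewrite addr_ge0// exprn_ge0.
rewrite normrM exprMn !exprM.
have : 0 <= `|Y t| ^+ k by rewrite exprn_ge0.
have : 0 <= `|Z t| ^+ k by rewrite exprn_ge0.
by move: (`|Y t| ^+ k) (`|Z t| ^+ k) => y z; nra.
Qed.

Lemma normD_power k (y z : R) :
  `|y + z| ^+ k <= 2 ^+ k * (`|y| ^+ k + `|z| ^+ k).
Proof.
wlog yz : y z / `|y| <= `|z|.
  move=> h; have [/h//|/ltW/h] := lerP `|y| `|z|.
  by rewrite [z + y]addrC [`|z| ^+ k + _]addrC.
apply: (@le_trans _ _ ((2 * `|z|) ^+ k)).
  rewrite lerXn2r ?nnegrE ?mulr_ge0//; apply: le_trans (ler_normD _ _) _.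
  by rewrite mulr_natl mulr2n lerD2r.
by rewrite exprMn ler_wpM2l ?exprn_ge0// lerDr exprn_ge0.
Qed.

Lemma all_momentsD Y Z : all_moments Y -> all_moments Z ->
  all_moments (fun t => Y t + Z t).
Proof.
move=> [mY iY] [mZ iZ]; have mYZ := measurable_funD mY mZ; split=> // k.
apply: le_integrable (integrableZl measurableT (2 ^+ k)
  (integrableD measurableT (iY k) (iZ k))) => //.
  by apply/measurable_EFinP/measurable_funX; exact: measurableT_comp.
move=> t _; rewrite /= lee_fin ger0_norm ?exprn_ge0//.
apply: le_trans (ler_norm _).
exact: normD_power.
Qed.

Lemma centered_gaussian_all_moments Y : centered_gaussian P Y -> all_moments Y.
Proof.
move=> gY; split=> [|k]; first by case: gY.
have [v /(_ k)[iY _]] := centered_gaussian_moments gY.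
have := integrable_abse iY; congr (P.-integrable _ _).
by apply/funext => t /=; rewrite normrX.
Qed.

Definition complex_moments f := all_moments (fun t => complex.Re (f t)) /\
  all_moments (fun t => complex.Im (f t)).

Let ReD (x y : R[i]) : complex.Re (x + y) = complex.Re x + complex.Re y.
Proof. by case: x y => [? ?] [? ?]. Qed.
Let ImD (x y : R[i]) : complex.Im (x + y) = complex.Im x + complex.Im y.
Proof. by case: x y => [? ?] [? ?]. Qed.
Let ReM (x y : R[i]) : complex.Re (x * y) =
  complex.Re x * complex.Re y + (-1) * (complex.Im x * complex.Im y).
Proof. by case: x y => [? ?] [? ?]; rewrite mulN1r. Qed.
Let ImM (x y : R[i]) : complex.Im (x * y) =
  complex.Re x * complex.Im y + complex.Im x * complex.Re y.
Proof. by case: x y => [? ?] [? ?]. Qed.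

Lemma cexpectE f : cexpect P f =
  (\int[P]_t complex.Re (f t)) +i* (\int[P]_t complex.Im (f t)).
Proof. by rewrite /cexpect unlock. Qed.

Lemma RintegralDm Y Z : all_moments Y -> all_moments Z ->
  \int[P]_t (Y t + Z t) = \int[P]_t Y t + \int[P]_t Z t.
Proof. by move=> mY mZ; rewrite RintegralD//; exact: all_moments_integrable. Qed.

Lemma RintegralZm r Y : all_moments Y ->
  \int[P]_t (r * Y t) = r * \int[P]_t Y t.
Proof. by move=> mY; rewrite RintegralZl//; exact: all_moments_integrable. Qed.

Lemma Rintegral_cstP r : \int[P]_t r = r.
Proof. by rewrite Rintegral_cst//= probability_setT mulr1. Qed.

Lemma expectation_cexpect : expectation_functional (cexpect P) complex_moments.
Proof.
split=> [k|f g [rf jf] [rg jg]|f g [rf jf] [rg jg]|k|f g [rf jf] [rg jg]|k f [rf jf]].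
- by split; exact: all_moments_cst.
- split; [under eq_fun do rewrite ReD|under eq_fun do rewrite ImD];
    exact: all_momentsD.
- split; [under eq_fun do rewrite ReM|under eq_fun do rewrite ImM].
    apply: all_momentsD; first exact: all_momentsM.
    exact: all_momentsM (all_moments_cst _) (all_momentsM jf jg).
  by apply: all_momentsD; exact: all_momentsM.
- by rewrite cexpectE !Rintegral_cstP; case: k.
- rewrite !cexpectE; under eq_Rintegral do rewrite ReD.
  under [X in _ +i* X = _]eq_Rintegral do rewrite ImD.
  by rewrite !RintegralDm.
- rewrite !cexpectE; under eq_Rintegral do rewrite ReM mulrA.
  under [X in _ +i* X = _]eq_Rintegral do rewrite ImM.
  have cM r Y : all_moments Y -> all_moments (fun t => r * Y t).
    by move=> mY; exact: all_momentsM (all_moments_cst _) mY.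
  rewrite !RintegralDm ?RintegralZm //; try exact: cM.
  by case: k => [u v]; apply/eqP; rewrite eq_complex /= mulN1r mulNr !eqxx.
Qed.

Lemma cexpect_conj f : complex_moments f ->
  cexpect P (fun t => (f t)^*) = (cexpect P f)^*.
Proof.
move=> [_ jf]; rewrite !cexpectE.
have conjE (x : R[i]) : complex.Re x^* = complex.Re x /\ complex.Im x^* = -1 * complex.Im x.
  by case: x => [u v]; rewrite mulN1r.
under eq_Rintegral do rewrite (conjE _).1.
under [X in _ +i* X = _]eq_Rintegral do rewrite (conjE _).2.
by rewrite RintegralZm// mulN1r.
Qed.

End AllMoments.

(** * Hermitian Gaussian matrices *)

Section HermitianGaussian.
Variables (R : realType) (d : measure_display) (T : measurableType d).
Variable P : probability T R.

Section RealSpan.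
Variables (J : eqType) (Z : J -> T -> R[i]).
Hypothesis gZ : centered_gaussian_family P Z.

(** Indexing by duplicate-free lists lets the coefficients be functions of the
    index. *)
Definition real_span (Y : T -> R) := exists (s : seq J) (a b : J -> R),
  uniq s /\ Y = fun t =>
    \sum_(j <- s) (a j * complex.Re (Z j t) + b j * complex.Im (Z j t)).

Definition complex_span (f : T -> R[i]) :=
  real_span (fun t => complex.Re (f t)) /\ real_span (fun t => complex.Im (f t)).

Lemma real_span_lin r Y Y' : real_span Y -> real_span Y' ->
  real_span (fun t => Y t + r * Y' t).
Proof.
move=> [s [a [b [us ->]]]] [s' [a' [b' [us' ->]]]].
pose S := undup (s ++ s').
have restrict (s0 : seq J) (F : J -> R) : uniq s0 -> {subset s0 <= S} ->
    \sum_(j <- s0) F j = \sum_(j <- S) (j \in s0)%:R * F j.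
  move=> us0 sS; rewrite [RHS](bigID (mem s0)) /= [X in _ + X]big1 => [|j /negbTE ->];
    last by rewrite mul0r.
  rewrite addr0 -[RHS]big_filter; under [RHS]eq_big_seq => j.
    rewrite mem_filter => /andP[-> _]; rewrite mul1r; over.
  apply: perm_big; apply: uniq_perm; rewrite ?filter_uniq ?undup_uniq// => j.
  by rewrite mem_filter; case: (boolP (j \in s0)) => // /sS ->.
exists S, (fun j => (j \in s)%:R * a j + r * ((j \in s')%:R * a' j)),
  (fun j => (j \in s)%:R * b j + r * ((j \in s')%:R * b' j)).
split; first exact: undup_uniq.
apply/funext => t; rewrite (restrict s) //; last first.
  by move=> j js; rewrite mem_undup mem_cat js.
rewrite (restrict s') //; last by move=> j js; rewrite mem_undup mem_cat js orbT.
rewrite mulr_sumr -big_split /=; apply: eq_bigr => j _; ring.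
Qed.

Lemma real_span_gaussian Y : real_span Y -> centered_gaussian P Y.
Proof. by move=> [s [a [b [_ ->]]]]; exact: gZ. Qed.

Lemma complex_span_family j : complex_span (Z j).
Proof.
split; [exists [:: j], (fun=> 1), (fun=> 0)|exists [:: j], (fun=> 0), (fun=> 1)];
  by split=> //; apply/funext => t; rewrite big_seq1 mul1r mul0r ?addr0 ?add0r.
Qed.

Lemma complex_span_lin k f g : complex_span f -> complex_span g ->
  complex_span (fun t => f t + k * g t).
Proof.
move=> [rf jf] [rg jg]; split.
  have := real_span_lin (- complex.Im k) (real_span_lin (complex.Re k) rf rg) jg.
  congr real_span; apply/funext => t.
  by case: (f t) (g t) k => [? ?] [? ?] [? ?] /=; ring.
have := real_span_lin (complex.Im k) (real_span_lin (complex.Re k) jf jg) rg.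
congr real_span; apply/funext => t.
by case: (f t) (g t) k => [? ?] [? ?] [? ?] /=; ring.
Qed.

Lemma complex_span_moments f : complex_span f -> complex_moments P f.
Proof.
by move=> [rf jf]; split; apply: centered_gaussian_all_moments;
  exact: real_span_gaussian.
Qed.

Lemma real_gaussian_moments Y : centered_gaussian P Y ->
  gaussian_moments (cexpect P) (fun t => (Y t)%:C).
Proof.
move=> gY; have [v vE] := centered_gaussian_moments gY.
have cE k : cexpect P (fun t => (Y t)%:C ^+ k) = (\int[P]_t (Y t ^+ k))%:C.
  rewrite cexpectE; under eq_Rintegral do rewrite -rmorphXn /=.
  under [X in _ +i* X = _]eq_Rintegral do rewrite -rmorphXn /=.
  by rewrite (Rintegral_cstP P 0).
have v2 : \int[P]_t (Y t ^+ 2) = v.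
  rewrite (vE 1%N).2 mulr1; under eq_Rintegral do rewrite expr0.
  by rewrite Rintegral_cstP mulr1.
move=> p; rewrite !cE (vE p).2 v2 !rmorphM /= rmorph_nat.
by rewrite [_ * v%:C]mulrC.
Qed.

Lemma complex_span_gaussian f : complex_span f ->
  gaussian_moments (cexpect P) f.
Proof.
move=> [rf jf].
have -> : f = (fun t => (complex.Re (f t))%:C + 'i%C * (complex.Im (f t))%:C).
  by apply/funext => t; case: (f t) => u v; apply/eqP; rewrite eq_complex /=;
    apply/andP; split; apply/eqP; ring.
have cm Y : real_span Y -> complex_moments P (fun t => (Y t)%:C).
  move=> /real_span_gaussian/centered_gaussian_all_moments mY; split => //.
  exact: all_moments_cst.
apply: (gaussian_moments_complex (expectation_cexpect P)); [exact: cm|exact: cm|].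
move=> n; have /real_span_gaussian/real_gaussian_moments :=
  real_span_lin n%:R rf jf.
congr gaussian_moments; apply/funext => t.
by rewrite rmorphD rmorphM rmorph_nat.
Qed.

End RealSpan.

Variables (H : lmodType R) (dot : {dot H for idfun}) (N : nat).
Variable X : H -> T -> 'M[R[i]]_N.
Hypothesis gX : hermitian_gaussian P dot X.
Notation entry := (fun (u : 'I_N * 'I_N * H) t => X u.2 t u.1.1 u.1.2).

Lemma real_dotC (x y : H) : dot x y = dot y x.
Proof. by rewrite hermC /= expr0 mul1r. Qed.

Lemma complex_span_entry h i j : complex_span entry (fun t => X h t i j).
Proof. exact: (complex_span_family entry (i, j, h)). Qed.

(** The hypotheses concern entries on or above the diagonal; conjugating an entry
    moves it to the transposed position and covers the other ones. *)
Lemma hermitian_covariance f h i j k l :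
  cexpect P (fun t => X f t i j * X h t k l) =
  ((i == l) && (j == k))%:R * (N%:R^-1 * (dot f h)%:C).
Proof.
have [herm fam low cov] := gX.
have covE f' h' (i' j' k' l' : 'I_N) : (i' <= j')%N -> (l' <= k')%N ->
    cexpect P (fun t => X f' t i' j' * X h' t k' l') =
    ((i' == l') && (j' == k'))%:R * (N%:R^-1 * (dot f' h')%:C).
  move=> ij lk; under eq_fun do rewrite [X h' _ k' l']herm.
  by rewrite cov// -natrM mulnb rmorphM /= fmorphV rmorph_nat.
have [lk|kl] := leqP l k; have [ij|ji] := leqP i j; first exact: covE.
- have [kl|lk'] := leqP k l.
    under eq_fun do rewrite mulrC; rewrite covE// 1?ltnW//.
    by rewrite real_dotC andbC [k == j]eq_sym [l == i]eq_sym.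
  under eq_fun do rewrite [X f _ i j]herm [X h _ k l]herm -rmorphM /=.
  rewrite cexpect_conj; last first.
    apply: (goodM (expectation_cexpect P)); apply: (complex_span_moments fam);
    exact: complex_span_entry.
  rewrite low// conjC0; case: eqP => [il|]; last by rewrite mul0r.
  case: eqP => [jk|]; last by rewrite mul0r.
  by move: ji lk'; rewrite il jk => h1 h2; have := ltn_trans h1 h2; rewrite ltnn.
- have [ji|ij'] := leqP j i.
    under eq_fun do rewrite mulrC; rewrite covE// 1?ltnW//.
    by rewrite real_dotC andbC [k == j]eq_sym [l == i]eq_sym.
  rewrite low//; case: eqP => [il|]; last by rewrite mul0r.
  case: eqP => [jk|]; last by rewrite mul0r.
  by move: ij' kl; rewrite il jk => h1 h2; have := ltn_trans h1 h2; rewrite ltnn.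
- under eq_fun do rewrite mulrC; rewrite covE// 1?ltnW//.
  by rewrite real_dotC andbC [k == j]eq_sym [l == i]eq_sym.
Qed.

Lemma hermitian_loop_equations : (0 < N)%N ->
  loop_equations (fun f h => (dot f h)%:C) N%:R^-1
    (fun w => N%:R^-1 * cexpect P (fun t => \tr (wordmx X w t)))
    (fun ws => cexpect P (centered_prod (cexpect P) X ws)).
Proof.
move=> N0; have [_ fam _ _] := gX.
apply: (gaussian_loop_equations (expectation_cexpect P)
  (complex_span_moments fam) (@complex_span_lin _ _) (complex_span_gaussian fam)).
- exact: complex_span_entry.
- exact: hermitian_covariance.
- by rewrite mulVf// pnatr_eq0 -lt0n.
Qed.

Lemma k2_trace u v :
  k2 P (fun t => \tr (wordmx X u t)) (fun t => \tr (wordmx X v t)) =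
  cexpect P (centered_prod (cexpect P) X [:: u; v]).
Proof.
have [_ fam _ _] := gX; have ax := expectation_cexpect P.
have gtr w : complex_moments P (fun t => \tr (wordmx X w t)).
  by apply: (good_tr ax (complex_span_moments fam)) => h i j; exact: complex_span_entry.
pose a := cexpect P (fun t => \tr (wordmx X u t)).
pose c := cexpect P (fun t => \tr (wordmx X v t)).
have -> : centered_prod (cexpect P) X [:: u; v] =
    (fun t => (\tr (wordmx X u t) * \tr (wordmx X v t) + (- a) * \tr (wordmx X v t)) +
       ((- c) * \tr (wordmx X u t) + a * c)).
  apply/funext => t; rewrite /centered_prod big_cons big_seq1 /centered -/a -/c.
  ring.
have guv : complex_moments P
    (fun t => \tr (wordmx X u t) * \tr (wordmx X v t)).
  exact: (goodM ax).
rewrite (expectD ax); last 2 first.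
- by apply: (goodD ax) => //; exact: (goodZ ax).
- by apply: (goodD ax); [exact: (goodZ ax)|exact: (good_cst ax)].
rewrite (expectD ax guv (goodZ ax _ (gtr v))) (expectM ax)//.
rewrite (expectD ax (goodZ ax _ (gtr u)) (good_cst ax _)) (expectM ax)//.
rewrite (expect_cst ax) /k2 -/a -/c; ring.
Qed.

End HermitianGaussian.

(** * The covariance on the Fock space *)

Section FockSide.
Variables (R : realType) (H : lmodType R) (dot : {dot H for idfun}).
Notation HC := (complexification H).
Notation words := (map (@of_real R H)).
Notation b := (fun f h : H => (dot f h)%:C).

Lemma pairing_prod (F : comNzRingType) (I : Type) (c : I -> I -> F) x0 s t :
  pairing c s t = if size s == size t then
    \prod_(i < size s) c (nth x0 s i) (nth x0 t i) else 0.
Proof.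
elim: s t => [|x s ih] [|y t] //=; first by rewrite big_ord0.
by rewrite eqSS ih big_ord_recl /=; case: eqP => // _; rewrite mulr0.
Qed.

Lemma cplx_dot_real (f h : H) : cplx_dot dot (of_real f) (of_real h) = b f h.
Proof.
by rewrite /cplx_dot /= !linear0r linear0l subr0 addr0.
Qed.

Lemma cplx_conj_real (f : H) : cplx_conj (of_real f) = of_real f.
Proof. by rewrite /cplx_conj /= oppr0. Qed.

(** Linearity over the real scalars is what the inner product has in both of its
    arguments. *)
Definition fock_real_linear (L : full_fock HC -> R[i]) :=
  {morph L : u v / u + v} /\
  (forall (r : R) (u : full_fock HC), L (r%:C *: u) = r%:C * L u).

Definition cyclic_real_linear (L : cyclic_fock HC -> R[i]) :=
  {morph L : u v / u + v} /\
  (forall (r : R) (u : cyclic_fock HC), L (r%:C *: u) = r%:C * L u).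

Lemma wick_omega (L : full_fock HC -> R[i]) (w : seq H) :
  fock_real_linear L ->
  L (foldr (omega dot) (vacuum _) w) = wick b (fun s => L (tensor (words s))) w.
Proof.
elim: w L => [//|f w ih] L [LD LZ] /=.
have L'lin : fock_real_linear (L \o omega dot f).
  split=> [u v|r u] /=; rewrite /omega.
    have cD : {morph creation (of_real f) : u v / u + v}.
      by move=> x y; have := creation_is_linear (of_real f) 1 x y; rewrite !scale1r.
    have aD : {morph annihilation dot (of_real f) : u v / u + v}.
      by move=> x y; have := annihilation_is_linear dot (of_real f) 1 x y; rewrite !scale1r.
    by rewrite cD aD addrACA; exact: LD.
  transitivity (L (r%:C *: creation (of_real f) u +
                   r%:C *: annihilation dot (of_real f) u)).
    congr (L (_ + _)).
      exact: (scalable_linear (creation_is_linear (of_real f)) r%:C u).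
    exact: (scalable_linear (annihilation_is_linear dot (of_real f)) r%:C u).
  by rewrite -scalerDr; exact: LZ.
transitivity (wick b (fun s => L (omega dot f (tensor (words s)))) w).
  exact: (ih _ L'lin).
apply: eq_wick => s; rewrite /omega creationE LD /dual_field; congr (_ + _).
case: s => [|g s] /=.
  rewrite [annihilation _ _ _]annihilation_vacuum.
  by have := LZ 0 0; rewrite scaler0 mul0r.
rewrite annihilationE cplx_dot_real real_dotC.
exact: LZ.
Qed.

Lemma cyclic_recursion_cword (L : cyclic_fock HC -> R[i]) :
  cyclic_real_linear L ->
  cyclic_recursion b (fun s => L (circular (words s)))
                     (fun s => L (cword dot (words s))).
Proof.
move=> [LD LZ]; have L0 : L 0 = 0 by have := LZ 0 0; rewrite scaler0 mul0r.
split=> [|f s]; first exact: L0.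
case/lastP: s => [|s g]; first by rewrite addr0.
rewrite rcontract_rcons /= map_rcons cword_rcons LD; congr (_ + _).
rewrite cplx_conj_real cplx_dot_real.
exact: LZ.
Qed.

(** The cyclic inner product of words is a sum over rotations, and a rotation is
    determined by the letter [x] of [t] that faces [f]. *)
Lemma cyc_word_cuts f s t : cyc_word dot (words (f :: s)) (words t) =
  cuts (fun a x c => b f x * pairing b s (c ++ a)) t.
Proof.
have size_rot (k : 'I_(size t)) :
    size (drop k.+1 t ++ take k t) = (size t).-1.
  rewrite size_cat size_drop size_takel; first by have := ltn_ord k; lia.
  exact/ltnW/ltn_ord.
rewrite (cuts_ord _ 0) /cyc_word !size_map.
case: eqP => [e|ne]; last first.
  rewrite big1 // => k _; rewrite (pairing_prod _ 0) size_rot ifN ?mulr0//.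
  apply/eqP => e; apply: ne; rewrite /= e prednK//.
  by apply: leq_ltn_trans (ltn_ord k).
rewrite -e /=; apply: eq_bigr => k _.
rewrite big_ord_recl /= (pairing_prod _ 0) add0n modn_small ?ltn_ord//.
have ltk' : (k < size t)%N by rewrite -e.
rewrite (size_rot (Ordinal ltk')) -e eqxx.
rewrite (nth_map 0) -?e ?ltn_ord// cplx_dot_real; congr (_ * _).
apply: eq_bigr => i _; rewrite /bump /= add1n add0n.
have lti := ltn_ord i; have ltk := ltn_ord k.
rewrite !(nth_map 0) ?cplx_dot_real -?e//; last by rewrite ltn_pmod.
congr ((dot _ _)%:C); rewrite nth_cat size_drop -e /=.
have [lt_ik|le_ki] := ltnP i ((size s).+1 - k.+1).
  rewrite nth_drop modn_small; last by lia.
  by congr nth; lia.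
rewrite nth_take; last by lia.
have -> : (i.+1 + k = (size s).+1 + (i - ((size s).+1 - k.+1)))%N by lia.
by rewrite modnDl modn_small; last by lia.
Qed.

Definition fock_covariance (u v : seq H) : R[i] :=
  cyc_dot dot (cmap dot (foldr (omega dot) (vacuum _) u))
              (cmap dot (foldr (omega dot) (vacuum _) (rev v))).

Lemma real_linear_cyc_dotl v : cyclic_real_linear (cyc_dot dot ^~ v).
Proof.
have cD x y : cyc_dot dot (x + y) v = cyc_dot dot x v + cyc_dot dot y v.
  by have := cyc_dotPl dot v 1 x y; rewrite scale1r mul1r.
split=> // r u.
have c0 : cyc_dot dot 0 v = 0 by apply: (addrI (cyc_dot dot 0 v)); rewrite -cD !addr0.
by have := cyc_dotPl dot v r%:C u 0; rewrite !addr0 c0 addr0.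
Qed.

Lemma real_linear_cyc_dotr u : cyclic_real_linear (cyc_dot dot u).
Proof.
have cD x y : cyc_dot dot u (x + y) = cyc_dot dot u x + cyc_dot dot u y.
  by have := cyc_dotPr dot u 1 x y; rewrite scale1r conjC1 mul1r.
split=> // r v.
have c0 : cyc_dot dot u 0 = 0 by apply: (addrI (cyc_dot dot u 0)); rewrite -cD !addr0.
have := cyc_dotPr dot u r%:C v 0; rewrite !addr0 c0 addr0 => ->.
by congr (_ * _); apply/eqP; rewrite eq_complex /= oppr0 !eqxx.
Qed.

Lemma real_linear_cmap (L : cyclic_fock HC -> R[i]) :
  cyclic_real_linear L -> fock_real_linear (L \o cmap dot).
Proof.
move=> [LD LZ]; split=> [u v|r u] /=.
  transitivity (L (cmap dot u + cmap dot v)); last exact: LD.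
  by congr L; have := cmap_is_linear dot 1 u v; rewrite !scale1r.
transitivity (L (r%:C *: cmap dot u)); last exact: LZ.
by congr L; exact: (scalable_linear (cmap_is_linear dot) r%:C u).
Qed.

Lemma fock_covariance_nil v : fock_covariance [::] v = 0.
Proof.
rewrite /fock_covariance /= cmap_vacuum; set x := cmap _ _.
have [_ /(_ 0 0)] := real_linear_cyc_dotl x.
by rewrite scaler0 mul0r.
Qed.

(** The first letter [f] is either contracted within its own word, or it stays
    open and faces an open letter [h] of the other word. *)
Lemma fock_covariance_cons f w v : fock_covariance (f :: w) v =
  cuts (fun a h x => b f h * (tau b a * fock_covariance x v +
                              tau b x * fock_covariance a v)) w +
  cuts (fun a h x => b f h * tau b (x ++ a ++ w)) v.
Proof.
have bC x y : b x y = b y x by rewrite real_dotC.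
pose V := cmap dot (foldr (omega dot) (vacuum _) (rev v)).
have cR := cyclic_recursion_cword (real_linear_cyc_dotl V).
have covE u : fock_covariance u v =
    wick b (fun s => cyc_dot dot (cword dot (words s)) V) u.
  rewrite /fock_covariance -/V.
  apply: etrans (wick_omega u (real_linear_cmap (real_linear_cyc_dotl V))) _.
  by apply: eq_wick => s /=; rewrite cmapE.
rewrite covE (wick_cyclic_recursion _ _ cR) [LHS]addrC; congr (_ + _).
  by apply: eq_cuts => a h x _; rewrite !covE.
transitivity (wick b (fun s => cuts (fun a h x =>
    b f h * wick b (pairing b s) (x ++ a)) (rev v)) w).
  apply: eq_wick => s; rewrite /V.
  have rl := real_linear_cyc_dotr (circular (words (f :: s))).
  apply: etrans (wick_omega (rev v) (real_linear_cmap rl)) _.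
  under eq_wick do rewrite /= cmapE.
  apply: (wick_cyclic_derivative bC (rev v) (cyclic_recursion_cword rl)) => t.
  by rewrite cyc_dotE cyc_word_cuts.
rewrite (wick_cuts _ (fun a h x s => b f h * wick b (pairing b s) (x ++ a))).
rewrite cuts_rev; apply: eq_cuts => a h x _.
by rewrite wickM (wick_pairing bC) rev_cat !revK catA.
Qed.

End FockSide.

Lemma cvg_complex_harmonic (R : realType) :
  (N.+1%:R^-1 : R[i]) @[N --> \oo] --> (0 : R[i]^o).
Proof.
apply/(@cvgr0Pnorm_lt R[i] R[i]^o) => eps; rewrite ltcE /= => /andP[/eqP im0 re0].
have : \forall N \near \oo, `|harmonic N : R| < complex.Re eps.
  exact: (@cvgr0_norm_lt R R^o nat \oo _ harmonic (@cvg_harmonic R)).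
apply: filterS => N hN.
have -> : (N.+1%:R^-1 : R[i]) = (N.+1%:R^-1 : R)%:C by rewrite fmorphV rmorph_nat.
rewrite normc_def /= expr0n addr0 sqrtr_sqr ltcE /= im0 eqxx /=.
exact: hN.
Qed.

(** * The limiting covariance *)

Theorem theorem5p3 (R : realType) (H : completeNormedModType R)
    (dot : {dot H for idfun}) (dotE : forall x : H, dot x x = `|x| ^+ 2)
    (d : nat -> measure_display) (T : forall N : nat, measurableType (d N))
    (P : forall N : nat, probability (T N) R)
    (X : forall N : nat, H -> T N -> 'M[R[i]]_N)
    (X_gauss : forall N : nat, hermitian_gaussian (P N) dot (X N))
    (n m : nat) (n_gt0 : (0 < n)%N) (m_gt0 : (0 < m)%N)
    (f : n.-tuple H) (g : m.-tuple H) :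
  k2 (P N) (fun t => \tr (\prod_(h <- f) X N h t))
           (fun t => \tr (\prod_(h <- g) X N h t)) @[N --> \oo] -->
  (cyc_dot dot (cmap dot (foldr (omega dot) (vacuum _) f))
               (cmap dot (foldr (omega dot) (vacuum _) (rev g))) : R[i]^o).
Proof.
(* The normalization [1 / N] makes sense in positive dimensions only. *)
pose u N : R[i]^o := k2 (P N) (fun t => \tr (wordmx (X N) f t))
                             (fun t => \tr (wordmx (X N) g t)).
suff : u N.+1 @[N --> \oo] --> (fock_covariance dot f g : R[i]^o).
  by have -> := @cvg_shiftS R[i]^o u (nbhs (fock_covariance dot f g : R[i]^o)).
under eq_fun => N do rewrite /u (k2_trace (X_gauss N.+1) f g).
apply: (@cvg_loop_c _ _ (fun x y : H => (dot x y)%:C) (fun N => N.+1%:R^-1)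
  (fun N w => N.+1%:R^-1 * cexpect (P N.+1) (fun t => \tr (wordmx (X N.+1) w t)))
  (fun N ws => cexpect (P N.+1) (centered_prod (cexpect (P N.+1)) (X N.+1) ws))
  _ _ (fock_covariance dot)).
- exact: cvg_complex_harmonic.
- by move=> N; exact: hermitian_loop_equations.
- exact: fock_covariance_nil.
- exact: fock_covariance_cons.
Qed.
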